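(* Let $(X,d,\mu)$ be a separable metric measure space and let $L$ be a non-negative self-adjoint operator on $L^2(X)$ whose spectrum is purely discrete, i.e. whose essential spectrum is empty. Let $\lambda_1<\lambda_2<\cdots<\lambda_k<\cdots$ be all the different eigenvalues of $L$. Assume that there exist constants $A,a>0$ such that for all large enough natural numbers $k$, $$k\leq A\lambda_k^a .$$ If $f\in L^2(X)$ satisfies $\log(2+L)f\in L^2(X)$, then $$\lim_{R\to\infty} S_R(L)f(x)=f(x)$$ for almost every $x\in X$. Moreover, for every compact subset $K$ of $X$ there exists a constant $C_K>0$ such that for all such $f$, $$\int_K \Big|\sup_{R>0}|S_R(L)f(x)|\Big|^2\,d\mu(x)\leq C_K\,\|\log(2+L)f\|_2^2 .$$
   Context: A metric measure space $(X,d,\mu)$ is a metric space $(X,d)$ with a Borel measure $\mu$ with respect to the topology defined by $d$; $L^2(X)=L^2(X,\mu)$. Write $L=\int_0^\infty\lambda\,dE_L(\lambda)$ for the spectral resolution of $L$. The spherical partial sums are $S_R(L)f=\int_0^R dE_L(\lambda)f$, i.e. $S_R(L)=\mathbf 1_{[0,R]}(L)$; since the spectrum is discrete, $S_R(L)f=\sum_{k:\lambda_k\le R}P_kf$ is a finite sum, where $P_k$ is the orthogonal projection onto the eigenspace of $\lambda_k$. The condition $\log(2+L)f\in L^2(X)$ means that $f$ lies in the domain of the self-adjoint operator $\log(2+L)$ (defined by the spectral theorem). For the pointwise statements, one representative of each $P_kf$ is fixed and $S_R(L)f(x)=\sum_{k:\lambda_k\le R}P_kf(x)$. *)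

(* Defs.v *)
From HB Require Import structures.
From mathcomp Require Import all_boot all_order all_algebra.
From mathcomp Require Import complex.
From mathcomp Require Import all_classical all_reals all_analysis.

Set Implicit Arguments.
Unset Strict Implicit.
Unset Printing Implicit Defensive.
Import Order.TTheory GRing.Theory Num.Theory.
Import numFieldNormedType.Exports.
Import Normc.

Local Open Scope classical_set_scope.
Local Open Scope ring_scope.

(* Nonempty metric spaces: the library builds the sigma-algebra generated by
   a family of sets only over a pointed type. *)
#[short(type="pmetricType")]
HB.structure Definition PMetric (K : numDomainType) :=
  { M of Metric K M & isPointed M }.

Notation borelType X := (g_sigma_algebraType (@open X)).

Definition separable_space (X : topologicalType) :=
  exists2 D : set X, countable D & dense D.

Section L2.
Context d (T : measurableType d) (R : realType).
Variable mu : {measure set T -> \bar R}.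
Local Notation C := (R[i]).
Implicit Types f g h u v w : T -> C.

(* Elements of L^2 are handled through representatives T -> C; equality in
   L^2 is equality mu-almost everywhere. *)
Definition L2norm f : \bar R := Lnorm mu 2%:E (fun x => (normc (f x))%:E).

Definition L2 : set (T -> C) := [set f |
  [/\ measurable_fun setT (fun x => complex.Re (f x)),
      measurable_fun setT (fun x => complex.Im (f x)) &
      (L2norm f < +oo)%E]].

Definition inner f g : C :=
  let p x := f x * (g x)^*%C in
  Complex (\int[mu]_x complex.Re (p x)) (\int[mu]_x complex.Im (p x)).

(* An unbounded operator is represented by its graph: [L u v] means that u
   represents an element of the domain and that v represents its image. *)
Record is_operator (L : (T -> C) -> (T -> C) -> Prop) : Prop := {
  op_L2 : forall u v, L u v -> L2 u /\ L2 v ;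
  op_ae : forall u v u' v', L u v -> L2 u' -> L2 v' ->
    u = u' %[ae mu] -> v = v' %[ae mu] -> L u' v' ;
  op_fun : forall u v v', L u v -> L u v' -> v = v' %[ae mu] ;
  op_lin : forall (c : C) u v u' v', L u v -> L u' v' ->
    L (fun x => c * u x + u' x) (fun x => c * v x + v' x) }.

Definition densely_defined (L : (T -> C) -> (T -> C) -> Prop) : Prop :=
  forall f, L2 f -> forall e : R, 0 < e ->
    exists u v, L u v /\ (L2norm (fun x => f x - u x)%R < e%:E)%E.

Definition adjoint (L : (T -> C) -> (T -> C) -> Prop) (u v : T -> C) : Prop :=
  [/\ L2 u, L2 v & forall w z, L w z -> inner z u = inner w v].

Definition self_adjoint (L : (T -> C) -> (T -> C) -> Prop) : Prop :=
  [/\ is_operator L, densely_defined L & forall u v, L u v <-> adjoint L u v].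

(* In the partial order of R[i], [0 <= z] says that z is real and z >= 0. *)
Definition nonnegative_op (L : (T -> C) -> (T -> C) -> Prop) : Prop :=
  forall u v, L u v -> 0 <= inner v u.

(* L - z maps its domain onto L^2 and has a bounded inverse; injectivity
   follows from the bound. *)
Definition resolvent_set (L : (T -> C) -> (T -> C) -> Prop) : set C := [set z |
  (forall h, L2 h ->
     exists u v, L u v /\ (fun x => v x - z * u x) = h %[ae mu]) /\
  (exists M : R, forall u v, L u v ->
     (L2norm u <= M%:E * L2norm (fun x => v x - z * u x)%R)%E)].

Definition spectrum (L : (T -> C) -> (T -> C) -> Prop) : set C :=
  ~` resolvent_set L.

Definition op_eigenspace (L : (T -> C) -> (T -> C) -> Prop) (z : C) :
  set (T -> C) := [set u | L u (fun x => z * u x)].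

Definition op_eigenvalue (L : (T -> C) -> (T -> C) -> Prop) (z : C) : Prop :=
  exists u, op_eigenspace L z u /\ ~ (u = cst 0 %[ae mu]).

Definition finite_multiplicity (L : (T -> C) -> (T -> C) -> Prop) (z : C) :
  Prop :=
  exists (n : nat) (e : 'I_n -> T -> C), (forall i, op_eigenspace L z (e i)) /\
    forall u, op_eigenspace L z u ->
      exists c : 'I_n -> C, u = (fun x => \sum_(i < n) c i * e i x) %[ae mu].

Definition discrete_spectrum (L : (T -> C) -> (T -> C) -> Prop) : set C :=
  [set z | [/\ spectrum L z, op_eigenvalue L z, finite_multiplicity L z &
    exists2 e : R, 0 < e &
      forall z1, spectrum L z1 -> normc (z1 - z) < e -> z1 = z]].

Definition essential_spectrum (L : (T -> C) -> (T -> C) -> Prop) : set C :=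
  spectrum L `\` discrete_spectrum L.

(* p represents the orthogonal projection of f onto the eigenspace of z. *)
Definition is_eigenprojection (L : (T -> C) -> (T -> C) -> Prop) (z : C)
    (f p : T -> C) : Prop :=
  op_eigenspace L z p /\
  forall u, op_eigenspace L z u -> inner (fun x => f x - p x) u = 0.

(* Projection-valued measures on the Borel sets of the real line. Linearity,
   compatibility with a.e. equality and E (A `&` B) = E A \o E B follow. *)
Record is_pvm (E : set R -> (T -> C) -> T -> C) : Prop := {
  pvm_L2 : forall B f, measurable B -> L2 f -> L2 (E B f) ;
  pvm_sym : forall B f g, measurable B -> L2 f -> L2 g ->
    inner (E B f) g = inner f (E B g) ;
  pvm_idem : forall B f, measurable B -> L2 f ->
    E B (E B f) = E B f %[ae mu] ;
  pvm_setT : forall f, L2 f -> E setT f = f %[ae mu] ;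
  pvm_sigma : forall (F : nat -> set R) f, (forall n, measurable (F n)) ->
    trivIset setT F -> L2 f ->
    L2norm (fun x => E (\bigcup_n F n) f x - \sum_(i < n) E (F i) f x)
      @[n --> \oo] --> 0%E }.

(* B |-> <E(B) f, f> *)
Definition spectral_measure (E : set R -> (T -> C) -> T -> C) f
    (B : set R) : \bar R := (complex.Re (inner (E B f) f))%:E.

(* The integral of phi against B |-> <E(B) f, h>, by polarization. *)
Definition spectral_form (E : set R -> (T -> C) -> T -> C) (phi : R -> R)
    f h : C :=
  4^-1 * \sum_(k < 4) 'i%C ^+ k * (fine (\int[spectral_measure E
    (fun x => f x + 'i%C ^+ k * h x)%R]_t (phi t)%:E)%E)%:C%C.

Definition spectral_domain (E : set R -> (T -> C) -> T -> C) (phi : R -> R) :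
  set (T -> C) := [set f | L2 f /\
    (\int[spectral_measure E f]_t (phi t ^+ 2)%:E < +oo)%E].

(* The graph of the operator \int phi dE: its domain is [spectral_domain E phi]
   and, the domain being dense, the image g of f is determined by its inner
   products with the elements of the domain. *)
Definition spectral_integral (E : set R -> (T -> C) -> T -> C) (phi : R -> R)
    (f g : T -> C) : Prop :=
  [/\ spectral_domain E phi f, L2 g &
      forall h, spectral_domain E phi h -> inner g h = spectral_form E phi f h].

Definition spectral_resolution (L : (T -> C) -> (T -> C) -> Prop)
    (E : set R -> (T -> C) -> T -> C) : Prop :=
  is_pvm E /\ forall f g, L f g <-> spectral_integral E idfun f g.

(* The graph of phi(L). By the spectral theorem a self-adjoint L has one and
   only one spectral resolution, up to a.e. equality. *)
Definition functional_calculus (L : (T -> C) -> (T -> C) -> Prop)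
    (phi : R -> R) (f g : T -> C) : Prop :=
  exists E, spectral_resolution L E /\ spectral_integral E phi f g.

End L2.

(* S_r(L)f(x), from representatives p k of the projections of f onto the
   eigenspaces of the lam k. The sum is finite when lam tends to infinity. *)
Definition spherical_sum (T : Type) (R : realType) (lam : nat -> R)
    (p : nat -> T -> R[i]) (r : R) (x : T) : R[i] :=
  \sum_(k \in [set k | lam k <= r]) p k x.

(* Main.v *)
(* Idea. Let E be the spectral resolution of L. If z is real and in the
   resolvent set, solving (L - z) u = h for h in the range of E(]z-e, z+e[)
   gives |h|^2 <= (e/2) (|u|^2 + |h|^2) with |u| <= M |h|, so E vanishes on a
   neighbourhood of z. As the essential spectrum is empty, E lives on the
   eigenvalues; hence f is the sum of its projections p_k = E({lam_k}) f in L2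
   and, by Bessel's inequality applied to g = log(2+L) f,
     sum_k log(2 + lam_k)^2 |p_k|^2 <= |g|^2.
   The growth condition makes log k = O(log(2 + lam_k)), so the orthogonal
   series sum_k p_k satisfies sum_k (log k)^2 |p_k|^2 <= c |g|^2, which is the
   hypothesis of the Rademacher-Menshov theorem. Its maximal inequality over
   the whole space is the second claim, for every K at once; applied to the
   tails of the series it gives the almost everywhere convergence. *)
Require Import Defs.
From HB Require Import structures.
From mathcomp Require Import all_boot all_order all_algebra.
From mathcomp Require Import complex.
From mathcomp Require Import all_classical all_reals all_analysis.
From mathcomp Require Import measurable_realfun.
From mathcomp Require Import ring lra zify.

Set Implicit Arguments.
Unset Strict Implicit.
Unset Printing Implicit Defensive.
Import Order.TTheory GRing.Theory Num.Theory.
Import numFieldNormedType.Exports.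
Import Normc.

Local Open Scope classical_set_scope.
Local Open Scope ring_scope.

(** [spectral_form] is defined by polarization, through [fine] of four integrals, so neither
    linearity nor locality in its arguments comes for free. The way out is to pair only with vectors
    h concentrated on a bounded set I: outside I the four spectral measures coincide, and since the
    powers of i sum to 0 that part cancels, provided it is finite. Two choices of I occur: a point
    l, which gives <phi(L) f, h> = phi(l) <f, h>, and a short interval, which gives the spectral
    gap. The [p k] are projections onto eigenspaces of L, not values of E. Identifying them with
    E({lam_k}) f requires every eigenvector to be concentrated at its eigenvalue; this comes from
    expanding it and using the orthogonality of distinct eigenspaces. In the Rademacher-Menshov part
    the supremum of the partial sums is never integrated directly: one measurable series W, built
    from the index blocks [2^j - 1, 2^(j+1) - 1), dominates all squared partial sums pointwise. Its
    integral is computed by orthogonality, and every pointwise estimate iterates a weighted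
    inequality for two terms. *)

(** * Complex L2 functions *)

Section ComplexParts.
Context (R : realType).
Implicit Types x y z : R[i].

Lemma ReD x y : complex.Re (x + y) = complex.Re x + complex.Re y.
Proof. by case: x; case: y. Qed.

Lemma ImD x y : complex.Im (x + y) = complex.Im x + complex.Im y.
Proof. by case: x; case: y. Qed.

Lemma ReM x y : complex.Re (x * y) =
  complex.Re x * complex.Re y - complex.Im x * complex.Im y.
Proof. by case: x; case: y. Qed.

Lemma ImM x y : complex.Im (x * y) =
  complex.Re x * complex.Im y + complex.Im x * complex.Re y.
Proof. by case: x => a b; case: y => c d. Qed.

Lemma ReN x : complex.Re (- x) = - complex.Re x.
Proof. by case: x. Qed.

Lemma ImN x : complex.Im (- x) = - complex.Im x.
Proof. by case: x. Qed.

Lemma ReJ x : complex.Re (x^*)%C = complex.Re x.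
Proof. by case: x. Qed.

Lemma ImJ x : complex.Im (x^*)%C = - complex.Im x.
Proof. by case: x. Qed.

Lemma conjcD x y : ((x + y)^*)%C = (x^*)%C + (y^*)%C.
Proof. exact: rmorphD. Qed.

Lemma conjcM x y : ((x * y)^*)%C = (x^*)%C * (y^*)%C.
Proof. exact: rmorphM. Qed.

Lemma conjcN x : ((- x)^*)%C = - (x^*)%C.
Proof. exact: rmorphN. Qed.

Definition csq z : R := complex.Re z ^+ 2 + complex.Im z ^+ 2.

Lemma csq_ge0 z : 0 <= csq z.
Proof. by rewrite addr_ge0 ?sqr_ge0. Qed.

Lemma csq_normc z : csq z = normc z ^+ 2.
Proof. by case: z => a b /=; rewrite sqr_sqrtr ?addr_ge0 ?sqr_ge0. Qed.

Lemma csq0 : csq 0 = 0.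
Proof. by rewrite /csq /= expr0n addr0. Qed.

Lemma csqN z : csq (- z) = csq z.
Proof. by rewrite /csq ReN ImN !sqrrN. Qed.

Lemma csqM x y : csq (x * y) = csq x * csq y.
Proof. by rewrite /csq ReM ImM; ring. Qed.

Lemma csq_eq0 z : csq z = 0 -> z = 0.
Proof.
by rewrite csq_normc => /eqP; rewrite sqrf_eq0 => /eqP /eq0_normc.
Qed.

(** Two-term Cauchy-Schwarz with weights: the difference of the two sides is |t x - s y|^2 / (s t).
    Choosing the weights at each step of an induction yields the constants of the Rademacher-Menshov
    inequality. *)
Lemma csqD_weighted (s t : R) x y : 0 < s -> 0 < t ->
  csq (x + y) <= (s + t) * (csq x / s + csq y / t).
Proof.
move=> s0 t0; rewrite -subr_ge0.
have -> : (s + t) * (csq x / s + csq y / t) - csq (x + y) =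
    ((complex.Re x * t - complex.Re y * s) ^+ 2
     + (complex.Im x * t - complex.Im y * s) ^+ 2) / (s * t).
  by rewrite /csq ReD ImD; field; rewrite !gt_eqF.
by rewrite divr_ge0 ?addr_ge0 ?sqr_ge0// mulr_ge0 ?ltW.
Qed.

Lemma csqD_le x y : csq (x + y) <= 2 * csq x + 2 * csq y.
Proof. by have := csqD_weighted x y ltr01 ltr01; rewrite !divr1; lra. Qed.

Lemma Re_sum I (s : seq I) (P : pred I) (F : I -> R[i]) :
  complex.Re (\sum_(i <- s | P i) F i) = \sum_(i <- s | P i) complex.Re (F i).
Proof. by apply: (big_morph (@complex.Re R)) => // x y; rewrite ReD. Qed.

End ComplexParts.

Section L2Theory.
Context d (T : measurableType d) (R : realType).
Variable mu : {measure set T -> \bar R}.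
Local Notation C := (R[i]).
Implicit Types f g h u v w : T -> C.
Local Notation inner := (inner mu).
Local Notation L2 := (L2 mu).

Definition cintegrable f :=
  mu.-integrable setT (EFin \o (fun x => complex.Re (f x))) /\
  mu.-integrable setT (EFin \o (fun x => complex.Im (f x))).

Definition cintegral f : C :=
  Complex (\int[mu]_x complex.Re (f x)) (\int[mu]_x complex.Im (f x)).

Lemma integrable_lin (a b : R) (r s : T -> R) :
  mu.-integrable setT (EFin \o r) -> mu.-integrable setT (EFin \o s) ->
  mu.-integrable setT (EFin \o (fun x => a * r x + b * s x)).
Proof.
move=> ir is_.
have := integrableD measurableT (integrableZl measurableT a ir)
  (integrableZl measurableT b is_).
by apply: eq_integrable => // x _ /=.
Qed.

Lemma Rintegral_lin (a b : R) (r s : T -> R) :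
  mu.-integrable setT (EFin \o r) -> mu.-integrable setT (EFin \o s) ->
  \int[mu]_x (a * r x + b * s x) = a * \int[mu]_x r x + b * \int[mu]_x s x.
Proof.
move=> ir is_; rewrite RintegralD//; first by rewrite !RintegralZl.
  by have := integrableZl measurableT a ir; apply: eq_integrable => // x _ /=.
by have := integrableZl measurableT b is_; apply: eq_integrable => // x _ /=.
Qed.

Lemma cintegral_lin (c : C) f g : cintegrable f -> cintegrable g ->
  cintegral (fun x => c * f x + g x) = c * cintegral f + cintegral g.
Proof.
move=> [fR fI] [gR gI]; apply/eqP; rewrite eq_complex ReD ImD ReM ImM /=.
apply/andP; split; apply/eqP.
- transitivity (\int[mu]_x (1 * (complex.Re c * complex.Re (f x)
      + (- complex.Im c) * complex.Im (f x)) + 1 * complex.Re (g x))).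
    by apply: eq_Rintegral => x _; rewrite ReD ReM; ring.
  by rewrite !Rintegral_lin//; [ring|exact: integrable_lin].
- transitivity (\int[mu]_x (1 * (complex.Re c * complex.Im (f x)
      + complex.Im c * complex.Re (f x)) + 1 * complex.Im (g x))).
    by apply: eq_Rintegral => x _; rewrite ImD ImM; ring.
  by rewrite !Rintegral_lin//; [ring|exact: integrable_lin].
Qed.

Lemma measurable_csq f : measurable_fun setT (fun x => complex.Re (f x)) ->
  measurable_fun setT (fun x => complex.Im (f x)) ->
  measurable_fun setT (fun x => csq (f x)).
Proof. by move=> fR fI; apply: measurable_funD; exact: measurable_funX. Qed.

Lemma L2norm_sqr f : ((L2norm mu f) ^+ 2 = \int[mu]_x (csq (f x))%:E)%E.
Proof.
rewrite /L2norm unlock poweR12_sqrt; last first.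
  by apply: integral_ge0 => x _; exact: poweR_ge0.
rewrite sqr_sqrte; last by apply: integral_ge0 => x _; exact: poweR_ge0.
apply: eq_integral => x _ /=.
by rewrite powR_mulrn// real_normK ?num_real// csq_normc.
Qed.

Lemma L2_integral_csq f : L2 f -> (\int[mu]_x (csq (f x))%:E < +oo)%E.
Proof.
move=> [_ _ foo]; rewrite -L2norm_sqr.
have : L2norm mu f \is a fin_num by rewrite ge0_fin_numE ?Lnorm_ge0.
by move/fineK => <-; rewrite -EFin_expe ltry.
Qed.

Lemma L2I f : measurable_fun setT (fun x => complex.Re (f x)) ->
  measurable_fun setT (fun x => complex.Im (f x)) ->
  (\int[mu]_x (csq (f x))%:E < +oo)%E -> L2 f.
Proof.
move=> fR fI foo; split => //; move: foo; rewrite -L2norm_sqr.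
have : (0 <= L2norm mu f)%E by exact: Lnorm_ge0.
by case: (L2norm mu f) => [r||] // _; rewrite ?ltry// expe2 mulyy.
Qed.

Lemma integrable_csq f : L2 f ->
  mu.-integrable setT (EFin \o (fun x => csq (f x))).
Proof.
move=> Lf; have [fR fI _] := Lf; apply/integrableP; split.
  by apply/measurable_EFinP; exact: measurable_csq.
under eq_integral do rewrite /= ger0_norm ?csq_ge0//.
exact: L2_integral_csq.
Qed.

Lemma measurable_Re_lin (c : C) f g : L2 f -> L2 g ->
  measurable_fun setT (fun x => complex.Re (c * f x + g x)).
Proof.
move=> [fR fI _] [gR gI _].
rewrite (_ : (fun x => _) = (fun x => complex.Re c * complex.Re (f x)
    - complex.Im c * complex.Im (f x) + complex.Re (g x))); last first.
  by apply/funext => x; rewrite ReD ReM.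
apply: measurable_funD => //.
by apply: measurable_funB; apply: measurable_funM.
Qed.

Lemma measurable_Im_lin (c : C) f g : L2 f -> L2 g ->
  measurable_fun setT (fun x => complex.Im (c * f x + g x)).
Proof.
move=> [fR fI _] [gR gI _].
rewrite (_ : (fun x => _) = (fun x => complex.Re c * complex.Im (f x)
    + complex.Im c * complex.Re (f x) + complex.Im (g x))); last first.
  by apply/funext => x; rewrite ImD ImM.
apply: measurable_funD => //.
by apply: measurable_funD; apply: measurable_funM.
Qed.

Lemma L2_lin (c : C) f g : L2 f -> L2 g -> L2 (fun x => c * f x + g x).
Proof.
move=> Lf Lg; have mR := measurable_Re_lin c Lf Lg.
have mI := measurable_Im_lin c Lf Lg.
apply: L2I => //.
have := integrable_lin (2 * csq c) 2 (integrable_csq Lf) (integrable_csq Lg).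
move=> /integrableP [mfg]; apply: le_lt_trans; apply: ge0_le_integral => //.
- by move=> x _; rewrite lee_fin csq_ge0.
- by apply/measurable_EFinP; apply: measurable_csq.
- exact: measurableT_comp.
move=> x _ /=; rewrite lee_fin; apply: le_trans (csqD_le _ _) _.
by rewrite csqM mulrA ler_norm.
Qed.

Lemma L2_cst0 : L2 (cst 0).
Proof.
by apply: L2I => //=; under eq_integral do rewrite /= csq0; rewrite integral0.
Qed.

Lemma L2Z (c : C) f : L2 f -> L2 (fun x => c * f x).
Proof.
by move=> /(L2_lin c)/(_ L2_cst0); under eq_fun do rewrite addr0.
Qed.

Lemma L2D f g : L2 f -> L2 g -> L2 (fun x => f x + g x).
Proof.
by move=> Lf /(L2_lin 1 Lf); under eq_fun do rewrite mul1r.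
Qed.

Lemma L2B f g : L2 f -> L2 g -> L2 (fun x => f x - g x).
Proof.
move=> Lf /(L2_lin (-1))/(_ Lf).
by under eq_fun do rewrite mulN1r addrC.
Qed.

Lemma L2_sum I (s : seq I) (F : I -> T -> C) :
  (forall i, L2 (F i)) -> L2 (fun x => \sum_(i <- s) F i x).
Proof.
move=> LF; elim: s => [|i s IH].
  by under eq_fun do rewrite big_nil; exact: L2_cst0.
by under eq_fun do rewrite big_cons; exact: L2D.
Qed.

(** Both parts of the product are dominated by |f|^2 + |g|^2. *)
Lemma cintegrable_innerM f g : L2 f -> L2 g ->
  cintegrable (fun x => f x * (g x)^*%C).
Proof.
move=> Lf Lg; have [fR fI _] := Lf; have [gR gI _] := Lg.
have ifg := integrable_lin 1 1 (integrable_csq Lf) (integrable_csq Lg).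
have H (r : T -> R) : measurable_fun setT r ->
    (forall x, `|r x| <= csq (f x) + csq (g x)) ->
    mu.-integrable setT (EFin \o r).
  move=> mr rle; apply: le_integrable ifg => //; first exact/measurable_EFinP.
  move=> x _ /=; rewrite lee_fin !mul1r; apply: le_trans (rle x) _.
  exact: ler_norm.
have am (a b s t : R) : `|a * b + s * t| <= a ^+ 2 + s ^+ 2 + (b ^+ 2 + t ^+ 2).
  have := (sqr_ge0 (a - b), sqr_ge0 (a + b), sqr_ge0 (s - t), sqr_ge0 (s + t)).
  move=> [[[h1 h2] h3] h4]; have := (sqr_ge0 a, sqr_ge0 b, sqr_ge0 s, sqr_ge0 t).
  by move=> [[[h5 h6] h7] h8]; rewrite ler_norml; apply/andP; split; lra.
split; apply: H.
- rewrite (_ : (fun x => _) = (fun x => complex.Re (f x) * complex.Re (g x)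
    + complex.Im (f x) * complex.Im (g x))); last first.
    by apply/funext => x; rewrite ReM ReJ ImJ mulrN opprK.
  by apply: measurable_funD; apply: measurable_funM.
- move=> x; rewrite ReM ReJ ImJ mulrN opprK; exact: am.
- rewrite (_ : (fun x => _) = (fun x => complex.Im (f x) * complex.Re (g x)
    - complex.Re (f x) * complex.Im (g x))); last first.
    by apply/funext => x; rewrite ImM ReJ ImJ mulrN addrC.
  by apply: measurable_funB; apply: measurable_funM.
- move=> x; rewrite ImM ReJ ImJ mulrN.
  rewrite -mulNr; apply: le_trans (am _ _ _ _) _.
  by rewrite /csq sqrrN; lra.
Qed.

Lemma inner_linl (c : C) f g h : L2 f -> L2 g -> L2 h ->
  inner (fun x => c * f x + g x) h = c * inner f h + inner g h.
Proof.
move=> Lf Lg Lh; rewrite /Defs.inner -!/(cintegral _) -cintegral_lin.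
- by congr cintegral; apply/funext => x; rewrite mulrDl mulrA.
- exact: cintegrable_innerM.
- exact: cintegrable_innerM.
Qed.

Lemma innerC f g : L2 f -> L2 g -> inner g f = (inner f g)^*%C.
Proof.
move=> Lf Lg; rewrite /Defs.inner; congr Complex.
  by apply: eq_Rintegral => x _; rewrite !ReM !ReJ !ImJ; ring.
have [_ ifg] := cintegrable_innerM Lf Lg.
transitivity (-1 * \int[mu]_x complex.Im (f x * (g x)^*%C)); last first.
  by rewrite mulN1r.
rewrite -RintegralZl//; apply: eq_Rintegral => x _.
by rewrite !ImM !ReJ !ImJ; ring.
Qed.

Lemma inner_linr (c : C) f g h : L2 f -> L2 g -> L2 h ->
  inner h (fun x => c * f x + g x) = c^*%C * inner h f + inner h g.
Proof.
move=> Lf Lg Lh; rewrite innerC//; last exact: L2_lin.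
by rewrite inner_linl// conjcD conjcM -!innerC.
Qed.

Lemma innerDl f g h : L2 f -> L2 g -> L2 h ->
  inner (fun x => f x + g x) h = inner f h + inner g h.
Proof.
move=> Lf Lg Lh; have := inner_linl 1 Lf Lg Lh.
by under eq_fun do rewrite mul1r; rewrite mul1r.
Qed.

Lemma innerDr f g h : L2 f -> L2 g -> L2 h ->
  inner h (fun x => f x + g x) = inner h f + inner h g.
Proof.
move=> Lf Lg Lh; have := inner_linr 1 Lf Lg Lh.
by under eq_fun do rewrite mul1r; rewrite conjc1 mul1r.
Qed.

Lemma innerBl f g h : L2 f -> L2 g -> L2 h ->
  inner (fun x => f x - g x) h = inner f h - inner g h.
Proof.
move=> Lf Lg Lh; have := inner_linl (-1) Lg Lf Lh.
by under eq_fun do rewrite mulN1r addrC; rewrite mulN1r addrC.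
Qed.

Lemma innerBr f g h : L2 f -> L2 g -> L2 h ->
  inner h (fun x => f x - g x) = inner h f - inner h g.
Proof.
move=> Lf Lg Lh; have := inner_linr (-1) Lg Lf Lh.
by under eq_fun do rewrite mulN1r addrC; rewrite conjcN conjc1 mulN1r addrC.
Qed.

Lemma inner0l h : inner (cst 0) h = 0.
Proof.
rewrite /Defs.inner; congr Complex; rewrite /Rintegral.
  by under eq_integral do rewrite /= mul0r; rewrite integral0.
by under eq_integral do rewrite /= mul0r; rewrite integral0.
Qed.

Lemma innerZl (c : C) f h : L2 f -> L2 h ->
  inner (fun x => c * f x) h = c * inner f h.
Proof.
move=> Lf Lh; have := inner_linl c Lf L2_cst0 Lh.
by under eq_fun do rewrite addr0; rewrite inner0l addr0.
Qed.

Lemma innerZr (c : C) f h : L2 f -> L2 h ->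
  inner h (fun x => c * f x) = c^*%C * inner h f.
Proof.
move=> Lf Lh; rewrite innerC//; last exact: L2Z.
by rewrite innerZl// conjcM -innerC.
Qed.

Lemma inner_suml I (s : seq I) (F : I -> T -> C) h :
  (forall i, L2 (F i)) -> L2 h ->
  inner (fun x => \sum_(i <- s) F i x) h = \sum_(i <- s) inner (F i) h.
Proof.
move=> LF Lh; elim: s => [|i s IH].
  by rewrite big_nil; under eq_fun do rewrite big_nil; exact: inner0l.
rewrite big_cons; under eq_fun do rewrite big_cons.
by rewrite innerDl ?IH//; exact: L2_sum.
Qed.

Lemma inner_ae f g f' g' : L2 f -> L2 g -> L2 f' -> L2 g' ->
  f = f' %[ae mu] -> g = g' %[ae mu] -> inner f g = inner f' g'.
Proof.
move=> Lf Lg Lf' Lg' ff' gg'.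
have [iR iI] := cintegrable_innerM Lf Lg.
have [iR' iI'] := cintegrable_innerM Lf' Lg'.
have E : ae_eq mu setT (fun x => f x * (g x)^*%C) (fun x => f' x * (g' x)^*%C).
  by apply: filterS2 ff' gg' => x + + _ => /(_ I) -> /(_ I) ->.
rewrite /Defs.inner; congr Complex; rewrite /Rintegral; congr fine.
- apply: (ae_eq_integral _ _ measurableT (measurable_int mu iR)
    (measurable_int mu iR')).
  by apply: filterS E => x /(_ I) E _ /=; rewrite E.
- apply: (ae_eq_integral _ _ measurableT (measurable_int mu iI)
    (measurable_int mu iI')).
  by apply: filterS E => x /(_ I) E _ /=; rewrite E.
Qed.

Lemma inner_normE f : L2 f ->
  (\int[mu]_x (csq (f x))%:E = (complex.Re (inner f f))%:E)%E.
Proof.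
move=> Lf; rewrite /Defs.inner /= /Rintegral fineK; last first.
  have [iR _] := cintegrable_innerM Lf Lf.
  exact: integrable_fin_num.
by apply: eq_integral => x _; rewrite ReM ReJ ImJ mulrN opprK.
Qed.

Lemma Re_inner_ge0 f : 0 <= complex.Re (inner f f).
Proof.
rewrite /Defs.inner /=; apply: Rintegral_ge0 => x _.
by rewrite ReM ReJ ImJ mulrN opprK -!expr2 addr_ge0 ?sqr_ge0.
Qed.

Lemma Im_inner f : complex.Im (inner f f) = 0.
Proof.
rewrite /Defs.inner /= /Rintegral; under eq_integral => x _.
  rewrite (_ : complex.Im _ = 0); last by rewrite ImM ReJ ImJ; ring.
  over.
by rewrite integral0.
Qed.

Lemma innerE f : inner f f = (complex.Re (inner f f))%:C%C.
Proof.
by have := Im_inner f; case: (inner f f) => a b /= ->.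
Qed.

Lemma inner_eq0 f : L2 f -> inner f f = 0 -> f = cst 0 %[ae mu].
Proof.
move=> Lf f0; have [fR fI _] := Lf.
have /ae_eq_integral_abs : measurable_fun setT (EFin \o (fun x => csq (f x))).
  by apply/measurable_EFinP; exact: measurable_csq.
move=> /(_ mu measurableT) [+ _].
rewrite (eq_integral (EFin \o (fun x => csq (f x)))); last first.
  by move=> x _ /=; rewrite ger0_norm// csq_ge0.
rewrite inner_normE// f0 => /(_ erefl).
by apply: filterS => x /(_ I) [/csq_eq0] + _.
Qed.

Lemma L2norm_sqrt f : L2 f ->
  L2norm mu f = (Num.sqrt (complex.Re (inner f f)))%:E.
Proof.
move=> Lf; have := L2norm_sqr f; rewrite inner_normE//.
have [_ _] := Lf; have : (0 <= L2norm mu f)%E by exact: Lnorm_ge0.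
case: (L2norm mu f) => [r||] //; rewrite lee_fin => r0 _.
rewrite -EFin_expe => E; rewrite (_ : complex.Re _ = r ^+ 2).
  by rewrite sqrtr_sqr ger0_norm.
by apply: EFin_inj; rewrite E.
Qed.

Lemma ae_eq_subr0 f g : (fun x => f x - g x) = cst 0 %[ae mu] <->
  f = g %[ae mu].
Proof.
split; apply: filterS => x /(_ I) fg _ /=.
  by apply/eqP; rewrite -subr_eq0; apply/eqP.
by rewrite fg subrr.
Qed.

Lemma cauchy_schwarz f g : L2 f -> L2 g ->
  csq (inner f g) <= complex.Re (inner f f) * complex.Re (inner g g).
Proof.
move=> Lf Lg; set F := complex.Re (inner f f); set G := complex.Re (inner g g).
have [F0 G0] : 0 <= F /\ 0 <= G by split; exact: Re_inner_ge0.
set c := csq (inner f g); have c0 : 0 <= c by exact: csq_ge0.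
(* 0 <= |f - t <f,g> g|^2, a quadratic polynomial in t *)
have H (t : R) : 0 <= t ^+ 2 * c * G - 2 * t * c + F.
  have := Re_inner_ge0 (fun x => (- t%:C%C * inner f g) * g x + f x).
  congr (0 <= _); rewrite inner_linl//; last exact: L2_lin.
  rewrite !inner_linr// (innerC Lf Lg) (innerE f) (innerE g) -/F -/G /c.
  by rewrite /csq; case: (inner f g) => a b /=; ring.
have [G00|Gn0] := eqVneq G 0.
  (* For G = 0 the polynomial is F - 2 t c; at this t it would equal -1, so c = 0. *)
  rewrite G00 mulr0; have := H ((F + 1) / (2 * c)); rewrite G00.
  have [->//|cn0] := eqVneq c 0.
  rewrite mulr0 add0r (_ : _ * _ * c = F + 1); last by field.
  by lra.
(* The minimum of the quadratic polynomial is attained at t = 1/G. *)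
have := H (G^-1).
rewrite (_ : _ + F = F - c / G); last by field.
by rewrite subr_ge0 ler_pdivrMr ?lt_neqAle ?G0 1?eq_sym ?Gn0.
Qed.

End L2Theory.

(** * The finite measures of a projection-valued measure *)

Section EqIntegral.
Import HBNNSimple.

(** The integral is built from simple functions, whose fibres are measurable. This replaces the bare
    set function [spectral_measure] by a genuine measure under the integral sign. *)
Lemma eq_integral_on_measurable d (T : measurableType d) (R : realType)
    (m1 m2 : set T -> \bar R) (D : set T) (f : T -> \bar R) :
  (forall B, measurable B -> m1 B = m2 B) ->
  (\int[m1]_(x in D) f x = \int[m2]_(x in D) f x)%E.
Proof.
move=> m12; have E (h : {nnsfun T >-> R}) : sintegral m1 h = sintegral m2 h.
  by apply: eq_fsbigr => x _; rewrite m12.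
rewrite /integral; congr (ereal_sup _ - ereal_sup _)%E;
  by rewrite eqEsubset; split => _ [h hf <-]; exists h.
Qed.

End EqIntegral.

Section SpectralMeasure.
Context d (T : measurableType d) (R : realType).
Variable mu : {measure set T -> \bar R}.
Local Notation C := (R[i]).
Implicit Types f g h u v w : T -> C.
Local Notation inner := (inner mu).
Local Notation L2 := (L2 mu).
Local Notation Re := complex.Re.
Variable E : set R -> (T -> C) -> T -> C.
Hypothesis pE : is_pvm mu E.
Implicit Types B : set R.

(** Linearity of [E B] is not a field of [is_pvm]; moving [E B] to the other argument by symmetry
    gives it inside an inner product, which suffices for the quadratic forms below. *)
Lemma pvm_linl B (c : C) f g h : measurable B -> L2 f -> L2 g -> L2 h ->
  inner (E B (fun x => c * f x + g x)) h = c * inner (E B f) h + inner (E B g) h.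
Proof.
move=> mB Lf Lg Lh; have LEh := pvm_L2 pE mB Lh.
rewrite (pvm_sym pE mB (L2_lin c Lf Lg) Lh) inner_linl//.
by rewrite -!(pvm_sym pE).
Qed.

Lemma pvm_linr B (c : C) f g h : measurable B -> L2 f -> L2 g -> L2 h ->
  inner (E B h) (fun x => c * f x + g x) =
  c^*%C * inner (E B h) f + inner (E B h) g.
Proof. by move=> mB Lf Lg Lh; rewrite inner_linr//; exact: (pvm_L2 pE). Qed.

Lemma pvm_herm B f g : measurable B -> L2 f -> L2 g ->
  inner (E B g) f = (inner (E B f) g)^*%C.
Proof.
move=> mB Lf Lg; rewrite (pvm_sym pE mB Lg Lf) innerC//.
exact: (pvm_L2 pE).
Qed.

Lemma pvm_norm B f : measurable B -> L2 f ->
  inner (E B f) f = inner (E B f) (E B f).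
Proof.
move=> mB Lf; have LEf := pvm_L2 pE mB Lf.
have LEEf := pvm_L2 pE mB LEf.
rewrite -(pvm_sym pE mB LEf Lf); apply: inner_ae => //; last exact: aeW.
by apply: ae_eq_sym; exact: (pvm_idem pE).
Qed.

Lemma pvm_ge0 B f : measurable B -> L2 f -> 0 <= Re (inner (E B f) f).
Proof. by move=> mB Lf; rewrite pvm_norm//; exact: Re_inner_ge0. Qed.

Lemma pvm_real B f : measurable B -> L2 f ->
  inner (E B f) f = (Re (inner (E B f) f))%:C%C.
Proof. by move=> mB Lf; rewrite pvm_norm//; exact: innerE. Qed.

Lemma pvm_setT_norm f : L2 f -> inner (E setT f) f = inner f f.
Proof.
move=> Lf; apply: inner_ae => //; last exact: aeW.
  exact: (pvm_L2 pE).
exact: (pvm_setT pE).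
Qed.

Lemma cvg_Re_inner (s : nat -> T -> C) f : (forall n, L2 (s n)) -> L2 f ->
  L2norm mu (s n) @[n --> \oo] --> 0%E ->
  Re (inner (s n) f) @[n --> \oo] --> (0 : R).
Proof.
move=> Ls Lf s0.
have {}s0 : Num.sqrt (Re (inner (s n) (s n))) @[n --> \oo] --> (0 : R).
  move: s0; rewrite (_ : (fun n => _) =
      EFin \o (fun n => Num.sqrt (Re (inner (s n) (s n))))).
    by move=> /fine_cvgP[_].
  by apply/funext => n /=; rewrite L2norm_sqrt.
pose t n : R := Num.sqrt (Re (inner (s n) (s n))).
pose c : R := Num.sqrt (Re (inner f f)).
have h : t n * c @[n --> \oo] --> (0 : R).
  by rewrite -(mul0r c); apply: cvgMr_tmp.
apply/cvgr0Pnorm_le => e e0; near=> n.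
apply: (@le_trans _ _ `|t n * c|); last first.
  by near: n; exact: (cvgr0_norm_le _ h _ e0).
rewrite [leRHS]ger0_norm ?mulr_ge0 ?sqrtr_ge0// -sqrtrM ?Re_inner_ge0//.
rewrite -sqrtr_sqr ler_wsqrtr//.
apply: le_trans (cauchy_schwarz (Ls n) Lf).
by rewrite /csq lerDl sqr_ge0.
Unshelve. all: by end_near. Qed.

Lemma pvm_sigma_form (F : nat -> set R) f : (forall n, measurable (F n)) ->
  trivIset setT F -> L2 f ->
  \sum_(i < n) Re (inner (E (F i) f) f) @[n --> \oo] -->
  Re (inner (E (\bigcup_n F n) f) f).
Proof.
move=> mF tF Lf; have mU : measurable (\bigcup_n F n).
  by apply: bigcupT_measurable.
have LU := pvm_L2 pE mU Lf.
have LF i := pvm_L2 pE (mF i) Lf.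
have := @cvg_Re_inner _ f _ Lf (pvm_sigma pE mF tF Lf).
move=> /(_ (fun n => L2B LU (L2_sum _ (fun i => LF _)))) h.
have {}h : Re (inner (E (\bigcup_n F n) f) f)
    - (\sum_(i < n) Re (inner (E (F i) f) f)) @[n --> \oo] --> (0 : R).
  apply: cvg_trans h; apply: near_eq_cvg; near=> n.
  rewrite innerBl//; last by apply: L2_sum => i.
  by rewrite inner_suml// ReD ReN Re_sum.
rewrite -[X in _ --> X]subr0.
apply: cvg_trans (cvgB (cvg_cst _) h).
by apply: near_eq_cvg; near=> n; rewrite /= subKr.
Unshelve. all: by end_near. Qed.

(** Sigma-additivity along a sequence of empty sets says that n copies of c add up to c in the
    limit; the difference of consecutive partial sums, c itself, then tends to 0. *)
Lemma pvm_set0_form f : L2 f -> Re (inner (E set0 f) f) = 0.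
Proof.
move=> Lf; have t0 : trivIset setT (fun _ : nat => set0 : set R).
  by apply/trivIsetP => i j _ _ _; rewrite setI0.
have := pvm_sigma_form (fun=> measurable0) t0 Lf; rewrite bigcup0//.
set c := Re _ => h.
have h1 : \sum_(i < n.+1) c @[n --> \oo] --> c.
  by rewrite (cvg_shiftS (fun n => \sum_(i < n) c)).
have h2 : (\sum_(i < n.+1) c - \sum_(i < n) c) @[n --> \oo] --> (0 : R).
  by rewrite -[X in _ --> X](subrr c); exact: (cvgB h1 h).
have : c @[n --> \oo] --> (0 : R).
  apply: cvg_trans h2; apply: near_eq_cvg; near=> n.
  by rewrite /= big_ord_recr /= addrAC subrr add0r.
by move/(cvg_lim (@Rhausdorff R)); rewrite lim_cst.
Unshelve. all: by end_near. Qed.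

(* The library requires a measure to be nonnegative on non-measurable sets
   too, where a projection-valued measure is arbitrary. *)
Definition pvm_measure (_ : is_pvm mu E) f (_ : L2 f) B : \bar R :=
  if `[< measurable B >] then (Re (inner (E B f) f))%:E else 0%E.

Section instance.
Variables (f : T -> C) (Lf : L2 f).
Local Notation m := (pvm_measure pE Lf).

Let m0 : m set0 = 0%E.
Proof. by rewrite /pvm_measure asboolT// pvm_set0_form. Qed.

Let m_ge0 B : (0 <= m B)%E.
Proof.
by rewrite /pvm_measure; case: asboolP => // mB; rewrite lee_fin pvm_ge0.
Qed.

Let m_sigma_additive : semi_sigma_additive m.
Proof.
move=> F mF tF mU; rewrite /pvm_measure asboolT//.
rewrite (_ : (fun n => _) =
    EFin \o (fun n => \sum_(i < n) Re (inner (E (F i) f) f))); last first.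
  apply/funext => n /=; rewrite big_mkord -sumEFin.
  by apply: eq_bigr => i _; rewrite asboolT.
by apply: cvg_EFin; [near=> n|exact: pvm_sigma_form].
Unshelve. all: by end_near. Qed.

HB.instance Definition _ := isMeasure.Build _ _ _ m m0 m_ge0 m_sigma_additive.

Lemma pvm_measureE B : measurable B -> m B = (Re (inner (E B f) f))%:E.
Proof. by move=> mB; rewrite /pvm_measure asboolT. Qed.

Lemma pvm_measure_lty B : measurable B -> (m B < +oo)%E.
Proof. by move=> mB; rewrite pvm_measureE// ltry. Qed.

Lemma integral_spectral_measure (D : set R) (phi : R -> \bar R) :
  (\int[spectral_measure mu E f]_(t in D) phi t = \int[m]_(t in D) phi t)%E.
Proof.
by apply: eq_integral_on_measurable => B mB; exact/esym/pvm_measureE.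
Qed.

End instance.

Lemma pvm_setC f B : measurable B -> L2 f ->
  Re (inner (E B f) f) + Re (inner (E (~` B) f) f) = Re (inner f f).
Proof.
move=> mB Lf; apply: EFin_inj; rewrite EFinD -!(pvm_measureE Lf)//; last first.
  exact: measurableC.
rewrite -measureU//; [|exact: measurableC|by rewrite setICr].
by rewrite setUv; apply: etrans (pvm_measureE Lf measurableT) _;
  rewrite pvm_setT_norm.
Qed.

Definition concentrated f B := E B f = f %[ae mu].

Lemma pvm_concentrated f B : measurable B -> L2 f -> concentrated (E B f) B.
Proof. exact: (pvm_idem pE). Qed.

(** B already carries the whole mass |f|^2 of the spectral measure of f, so its complement, and with
    it D, carries none. *)
Lemma concentrated_disjoint f B D : measurable B -> measurable D -> L2 f ->
  concentrated f B -> B `&` D = set0 -> E D f = cst 0 %[ae mu].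
Proof.
move=> mB mD Lf cf BD0; have LEf := pvm_L2 pE mD Lf.
apply: inner_eq0 => //; rewrite -pvm_norm// pvm_real//.
suff : Re (inner (E D f) f) <= 0.
  by move=> h; rewrite (_ : Re _ = 0)//; apply/eqP; rewrite eq_le h pvm_ge0.
have mCB : measurable (~` B) by exact: measurableC.
have -> : 0 = Re (inner (E (~` B) f) f).
  have := pvm_setC mB Lf.
  rewrite (@inner_ae _ _ _ _ (E B f) f f f)//; last 2 first.
  - exact: (pvm_L2 pE).
  - exact: aeW.
  by lra.
rewrite -lee_fin -!(pvm_measureE Lf)//; apply: le_measure; rewrite ?inE//.
by rewrite -disjoints_subset setIC.
Qed.

Lemma concentrated_disjoint_innerl f g B D :
  measurable B -> measurable D -> L2 f -> L2 g ->
  concentrated f B -> B `&` D = set0 -> inner (E D f) g = 0.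
Proof.
move=> mB mD Lf Lg cf BD0; rewrite -(inner0l mu g).
apply: inner_ae => //; [exact: (pvm_L2 pE)|exact: L2_cst0| |exact: aeW].
exact: concentrated_disjoint BD0.
Qed.

Lemma concentrated_disjoint_innerr f g B D :
  measurable B -> measurable D -> L2 f -> L2 g ->
  concentrated f B -> B `&` D = set0 -> inner (E D g) f = 0.
Proof.
move=> mB mD Lf Lg cf BD0; rewrite pvm_herm//.
by rewrite (concentrated_disjoint_innerl mB)// conjc0.
Qed.

Lemma concentrated_inner f g B : measurable B -> L2 f -> L2 g ->
  concentrated f B -> inner (E B g) f = inner g f.
Proof.
move=> mB Lf Lg cf; rewrite (pvm_sym pE)//.
by apply: inner_ae => //; [exact: (pvm_L2 pE)|exact: aeW].
Qed.

End SpectralMeasure.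

(** * Localization of the spectral form *)

Section AgreeOff.
Context (R : realType).
Variables m1 m2 : {measure set R -> \bar R}.
Variables (I : set R) (phi : R -> R).
Hypothesis mI : measurable I.
Hypothesis mphi : measurable_fun setT phi.
Hypothesis m12 : forall B, measurable B -> B `<=` ~` I -> m1 B = m2 B.

Let I_C : setT = I `|` ~` I. Proof. by rewrite setUv. Qed.

Let disjIC : [disjoint I & ~` I]. Proof. by rewrite disj_set2E setICr. Qed.

Lemma integral_agree_off :
  (\int[m1]_t (phi t)%:E =
   \int[m1]_(t in I) (phi t)%:E + \int[m2]_(t in ~` I) (phi t)%:E)%E.
Proof.
have mC := measurableC mI.
rewrite {1}I_C integral_setU//; last first.
  by rewrite -I_C; exact/measurable_EFinP.
by congr (_ + _)%E; apply: eq_measure_integral.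
Qed.

(** On I a bounded function is integrable for a finite mass; off I integrability is inherited from
    m2, which will be the spectral measure of a domain element or the zero measure. *)
Lemma integrable_agree_off (b : R) : (m1 I < +oo)%E ->
  (forall t, I t -> `|phi t| <= b) ->
  m2.-integrable setT (EFin \o phi) -> m1.-integrable setT (EFin \o phi).
Proof.
move=> m1I phib i2; have mC := measurableC mI.
have mE : measurable_fun setT (EFin \o phi) by exact/measurable_EFinP.
apply/integrableP; split => //.
have -> : (\int[m1]_t `|(EFin \o phi) t| =
    \int[m1]_(t in I `|` ~` I) `|(EFin \o phi) t|)%E by rewrite -I_C.
rewrite ge0_integral_setU//; last first.
  by rewrite -I_C; exact: measurableT_comp.
apply: lte_add_pinfty.
  have : m1.-integrable I (EFin \o phi).
    apply: measurable_bounded_integrable => //; first exact: measurable_funTS.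
    exists b; split; first exact: num_real.
    by move=> y by_ t It; apply: le_trans (phib t It) (ltW by_).
  by move=> /integrableP[].
rewrite (@eq_measure_integral _ _ _ _ m2)//.
by have /integrableP[] := integrableS measurableT mC (@subsetT _ _) i2.
Qed.

End AgreeOff.

Section SpectralForm.
Context d (T : measurableType d) (R : realType).
Variable mu : {measure set T -> \bar R}.
Local Notation C := (R[i]).
Implicit Types f g h u v w : T -> C.
Local Notation inner := (inner mu).
Local Notation L2 := (L2 mu).
Local Notation Re := complex.Re.
Variable E : set R -> (T -> C) -> T -> C.
Hypothesis pE : is_pvm mu E.
Implicit Types B : set R.
Local Notation concentrated := (concentrated mu E).

Lemma sum4 (V : nmodType) (F : nat -> V) :
  \sum_(k < 4) F k = F 0%N + F 1%N + F 2%N + F 3%N.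
Proof. by rewrite !big_ord_recr big_ord0 /= add0r. Qed.

Lemma powi (c : C) : [/\ 'i%C ^+ 0 * c = c, 'i%C ^+ 1 * c = 'i%C * c,
  'i%C ^+ 2 * c = - c & 'i%C ^+ 3 * c = - ('i%C * c)].
Proof.
by split; rewrite ?expr0 ?expr1 ?mul1r// ?exprS ?expr0 ?mulr1;
  case: c => a b; apply/eqP; rewrite eq_complex /=; apply/andP; split;
  apply/eqP; ring.
Qed.

Lemma sum_powi (c : C) : \sum_(k < 4) 'i%C ^+ k * c = 0.
Proof.
rewrite (sum4 (fun k => 'i%C ^+ k * c)).
by have [-> -> -> ->] := powi c; ring.
Qed.

Lemma csq_powi k : csq ('i%C ^+ k : C) = 1.
Proof.
elim: k => [|k IH]; first by rewrite /csq /=; ring.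
by rewrite exprS csqM IH /csq /=; ring.
Qed.

Lemma pvm_normD B (c : C) u v : measurable B -> L2 u -> L2 v ->
  Re (inner (E B (fun x => u x + c * v x)) (fun x => u x + c * v x)) =
  Re (inner (E B u) u) + csq c * Re (inner (E B v) v)
    + 2 * Re (c^*%C * inner (E B u) v).
Proof.
move=> mB Lu Lv.
have -> : (fun x => u x + c * v x) = (fun x => c * v x + u x).
  by apply/funext => x; rewrite addrC.
have Lw := L2_lin c Lv Lu.
rewrite (pvm_linl pE)// !(pvm_linr pE)// (pvm_herm pE mB Lu Lv).
rewrite (pvm_real pE mB Lu) (pvm_real pE mB Lv) /csq.
case: c {Lw} => c1 c2; case: (inner (E B u) v) => a b.
by move: (Re (inner (E B u) u)) (Re (inner (E B v) v)) => U V /=; ring.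
Qed.

Lemma pvm_polarization B u v : measurable B -> L2 u -> L2 v ->
  4^-1 * \sum_(k < 4) 'i%C ^+ k * (Re (inner (E B
    (fun x => u x + 'i%C ^+ k * v x)) (fun x => u x + 'i%C ^+ k * v x)))%:C%C
  = inner (E B u) v.
Proof.
move=> mB Lu Lv; under eq_bigr do rewrite pvm_normD// csq_powi.
move: (Re (inner (E B u) u)) (Re (inner (E B v) v)) => U V.
case: (inner (E B u) v) => a b.
rewrite (sum4 (fun k => 'i%C ^+ k *
  (U + 1 * V + 2 * Re (('i%C ^+ k)^*%C * Complex a b))%:C%C)).
have pw (c : C) := let: And4 h0 h1 h2 h3 := powi c in (h0, h1, h2, h3).
rewrite !pw; have [[[_ _] i2] i3] := pw 1; rewrite !mulr1 in i2 i3.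
rewrite i2 i3 expr0 expr1.
apply: (mulfI (_ : 4%:R != 0 :> C)); first by rewrite pnatr_eq0.
rewrite mulrA divff ?mul1r; last by rewrite pnatr_eq0.
by apply/eqP; rewrite eq_complex /=; apply/andP; split; apply/eqP; ring.
Qed.

(** The spectral measure is finite and |phi| <= 1 + phi^2. *)
Lemma spectral_domain_integrable (phi : R -> R) r (Lr : L2 r) :
  measurable_fun setT phi -> spectral_domain mu E phi r ->
  (pvm_measure pE Lr).-integrable setT (EFin \o phi).
Proof.
move=> mphi [_]; rewrite (integral_spectral_measure pE Lr) => foo.
have i2 : (pvm_measure pE Lr).-integrable setT (EFin \o (fun t => phi t ^+ 2)).
  apply/integrableP; split.
    by apply/measurable_EFinP; exact: measurable_funX.
  by under eq_integral do rewrite /= ger0_norm ?sqr_ge0//.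
have i1 : (pvm_measure pE Lr).-integrable setT (EFin \o cst 1).
  apply: measurable_bounded_integrable => //; first exact: pvm_measure_lty.
  exists 1; split; first exact: num_real.
  by move=> y y1 t _ /=; rewrite normr1 ltW.
have := integrable_lin 1 1 i1 i2.
apply: le_integrable => //; first exact/measurable_EFinP.
move=> t _ /=; rewrite lee_fin !mul1r [leRHS]ger0_norm; last first.
  by rewrite addr_ge0 ?sqr_ge0.
rewrite -[X in _ + X]real_normK ?num_real//.
by move: (`|phi t|) (normr_ge0 (phi t)) => y y0; nra.
Qed.

(** Outside I the four measures all equal that of r, so the four integrals share a term K and the
    sum of i^k K over k < 4 vanishes. The domain condition on r makes K finite, so that [fine] is
    additive. In the applications r is u or v, whichever need not be concentrated on I. *)
Lemma spectral_form_localized (I : set R) (phi : R -> R) (b : R) u v r :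
  measurable I -> measurable_fun setT phi -> (forall t, I t -> `|phi t| <= b) ->
  L2 u -> L2 v -> spectral_domain mu E phi r ->
  (forall k B, measurable B -> I `&` B = set0 ->
     Re (inner (E B (fun x => u x + 'i%C ^+ k * v x))
       (fun x => u x + 'i%C ^+ k * v x)) = Re (inner (E B r) r)) ->
  spectral_form mu E phi u v = 4^-1 * \sum_(k < 4) 'i%C ^+ k *
    (fine (\int[spectral_measure mu E (fun x => u x + 'i%C ^+ k * v x)]_(t in I)
      (phi t)%:E))%:C%C.
Proof.
move=> mI mphi phib Lu Lv dr agree; have [Lr _] := dr.
have ir := spectral_domain_integrable Lr mphi dr.
pose w k x := u x + 'i%C ^+ k * v x.
have Lw k : L2 (w k).
  by have := L2_lin ('i%C ^+ k) Lv Lu; rewrite /w; under eq_fun do rewrite addrC.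
have agree' k B : measurable B -> B `<=` ~` I ->
    pvm_measure pE (Lw k) B = pvm_measure pE Lr B.
  move=> mB BI; rewrite !pvm_measureE// agree//.
  by rewrite setIC; apply/disjoints_subset.
pose K := (\int[pvm_measure pE Lr]_(t in ~` I) (phi t)%:E)%E.
have fK : K \is a fin_num.
  apply: integrable_fin_num; first exact: measurableC.
  by apply: integrableS ir => //; exact: measurableC.
have split_k k : (fine (\int[spectral_measure mu E (w k)]_t (phi t)%:E))%:C%C =
    (fine (\int[spectral_measure mu E (w k)]_(t in I) (phi t)%:E))%:C%C
    + (fine K)%:C%C :> C.
  rewrite !(integral_spectral_measure pE (Lw k)).
  have iw : (pvm_measure pE (Lw k)).-integrable setT (EFin \o phi).
    apply: (integrable_agree_off mI mphi (agree' k) _ phib ir).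
    exact: pvm_measure_lty.
  have fI := integrable_fin_num mI (integrableS measurableT mI (@subsetT _ _) iw).
  by rewrite (integral_agree_off mI mphi (agree' k)) (fineD fI fK) rmorphD.
rewrite /spectral_form; congr (_ * _).
under eq_bigr do rewrite (split_k _) mulrDr.
by rewrite big_split /= sum_powi addr0.
Qed.

End SpectralForm.

(** * Spectral integrals tested against concentrated vectors *)

Section Resolution.
Context d (T : measurableType d) (R : realType).
Variable mu : {measure set T -> \bar R}.
Local Notation C := (R[i]).
Implicit Types f g h u v w : T -> C.
Local Notation inner := (inner mu).
Local Notation L2 := (L2 mu).
Local Notation Re := complex.Re.
Variable E : set R -> (T -> C) -> T -> C.
Hypothesis pE : is_pvm mu E.
Implicit Types (B I : set R) (phi : R -> R).
Local Notation concentrated := (concentrated mu E).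

(** Off I the square of v and both cross terms vanish. This is the agreement hypothesis of
    [spectral_form_localized] with r = u; the next lemma provides it with r = v. *)
Lemma concentrated_agree_r I B (c : C) u v : measurable I -> measurable B ->
  L2 u -> L2 v -> concentrated v I -> I `&` B = set0 ->
  Re (inner (E B (fun x => u x + c * v x)) (fun x => u x + c * v x)) =
  Re (inner (E B u) u).
Proof.
move=> mI mB Lu Lv cv IB; rewrite (pvm_normD pE)//.
rewrite (concentrated_disjoint_innerl pE mI mB Lv Lv cv IB).
rewrite (concentrated_disjoint_innerr pE mI mB Lv Lu cv IB).
by rewrite mulr0 /= !mulr0 !addr0.
Qed.

Lemma concentrated_agree_l I B (c : C) u v : measurable I -> measurable B ->
  L2 u -> L2 v -> csq c = 1 -> concentrated u I -> I `&` B = set0 ->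
  Re (inner (E B (fun x => u x + c * v x)) (fun x => u x + c * v x)) =
  Re (inner (E B v) v).
Proof.
move=> mI mB Lu Lv c1 cu IB; rewrite (pvm_normD pE)//.
rewrite (concentrated_disjoint_innerl pE mI mB Lu Lu cu IB).
rewrite (concentrated_disjoint_innerl pE mI mB Lu Lv cu IB).
by rewrite c1 mulr0 /= !mulr0 !addr0 mul1r add0r.
Qed.

Lemma concentrated_domain I phi (b : R) v : measurable I ->
  measurable_fun setT phi -> (forall t, I t -> `|phi t| <= b) ->
  L2 v -> concentrated v I -> spectral_domain mu E phi v.
Proof.
move=> mI mphi phib Lv cv; split => //.
rewrite (integral_spectral_measure pE Lv).
have mphi2 : measurable_fun setT (fun t => phi t ^+ 2) by exact: measurable_funX.
have : (pvm_measure pE Lv).-integrable setT (EFin \o (fun t => phi t ^+ 2)).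
  (* Off I the spectral measure of v agrees with the zero measure. *)
  apply: (@integrable_agree_off _ _ mzero I _ mI mphi2 _ (b ^+ 2)).
  - move=> B mB BI; apply: etrans (pvm_measureE pE Lv mB) _.
    rewrite (concentrated_disjoint_innerl pE mI mB Lv Lv cv)//.
    by rewrite setIC; apply/disjoints_subset.
  - exact: pvm_measure_lty.
  - move=> t It; rewrite normrX lerXn2r// ?nnegrE//.
      exact: le_trans (normr_ge0 _) (phib t It).
    exact: phib.
  - apply/integrableP; split; first exact/measurable_EFinP.
    by rewrite integral_measure_zero ltry.
move=> /integrableP[_]; under eq_integral do rewrite /= ger0_norm ?sqr_ge0//.
by [].
Qed.

(** On a single point each integral is [phi l] times a mass, and polarization reassembles the four
    masses into an inner product. *)
Lemma spectral_form_point phi (l : R) u v r :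
  measurable_fun setT phi -> L2 u -> L2 v -> spectral_domain mu E phi r ->
  (forall k B, measurable B -> [set l] `&` B = set0 ->
     Re (inner (E B (fun x => u x + 'i%C ^+ k * v x))
       (fun x => u x + 'i%C ^+ k * v x)) = Re (inner (E B r) r)) ->
  spectral_form mu E phi u v = (phi l)%:C%C * inner (E [set l] u) v.
Proof.
move=> mphi Lu Lv dr agree.
rewrite (@spectral_form_localized _ _ _ _ _ pE [set l] phi `|phi l| u v r)//.
- rewrite -(pvm_polarization pE)// mulrCA; congr (_ * _).
  rewrite mulr_sumr; apply: eq_bigr => k _; rewrite mulrCA; congr (_ * _).
  have Lw : L2 (fun x => u x + 'i%C ^+ k * v x).
    by have := L2_lin ('i%C ^+ k) Lv Lu; under eq_fun do rewrite addrC.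
  rewrite (integral_spectral_measure pE Lw).
  rewrite (eq_integral (cst (phi l)%:E)); last first.
    by move=> t; rewrite inE => ->.
  rewrite integral_cst//.
  rewrite [X in (_ * X)%E](pvm_measureE pE Lw)//.
  by rewrite -EFinM /= rmorphM.
- by move=> t ->.
Qed.

Lemma spectral_form_point_r phi (l : R) u v : measurable_fun setT phi ->
  spectral_domain mu E phi u -> L2 v -> concentrated v [set l] ->
  spectral_form mu E phi u v = (phi l)%:C%C * inner u v.
Proof.
move=> mphi du Lv cv; have [Lu _] := du.
rewrite (@spectral_form_point phi l u v u)//.
  by rewrite (concentrated_inner pE).
move=> k B mB lB; exact: concentrated_agree_r lB.
Qed.

Lemma spectral_form_point_l phi (l : R) u v : measurable_fun setT phi ->
  spectral_domain mu E phi v -> L2 u -> concentrated u [set l] ->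
  spectral_form mu E phi u v = (phi l)%:C%C * inner u v.
Proof.
move=> mphi dv Lu cu; have [Lv _] := dv.
rewrite (@spectral_form_point phi l u v v)//.
  rewrite (@inner_ae _ _ _ _ (E [set l] u) v u v)//; last exact: aeW.
  exact: (pvm_L2 pE).
by move=> k B mB lB; apply: concentrated_agree_l lB => //; exact: csq_powi.
Qed.

(** A vector concentrated at a point lies in the domain for every measurable phi, so it may be used
    as a test vector. With phi = ln (2 + t) this gives the coefficients of g along eigenvectors. *)
Lemma spectral_integral_inner phi (l : R) f g v : measurable_fun setT phi ->
  spectral_integral mu E phi f g -> L2 v -> concentrated v [set l] ->
  inner g v = (phi l)%:C%C * inner f v.
Proof.
move=> mphi [df Lg gE] Lv cv; rewrite gE; first exact: spectral_form_point_r.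
by apply: (@concentrated_domain [set l] phi `|phi l|) => // t ->.
Qed.

Lemma spectral_integral_point phi (l : R) v : measurable_fun setT phi ->
  L2 v -> concentrated v [set l] ->
  spectral_integral mu E phi v (fun x => (phi l)%:C%C * v x).
Proof.
move=> mphi Lv cv; split; last 2 first.
- exact: L2Z.
- move=> h dh; have [Lh _] := dh; rewrite innerZl//.
  exact/esym/spectral_form_point_l.
by apply: (@concentrated_domain [set l] phi `|phi l|) => // t ->.
Qed.

Variable L : (T -> C) -> (T -> C) -> Prop.
Hypothesis LE : forall f g, L f g <-> spectral_integral mu E idfun f g.

Lemma eigenspace_pvm (l : R) h : L2 h ->
  op_eigenspace L (l%:C)%C (E [set l] h).
Proof.
move=> Lh; have Ll := pvm_L2 pE (measurable_set1 l) Lh.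
apply/LE; apply: (@spectral_integral_point idfun l _ (@measurable_id _ _ _) Ll).
exact: (pvm_concentrated pE).
Qed.

Lemma integral_itv_bounds (m : {measure set R -> \bar R}) (z e : R) :
  let I := `]z - e, z + e[%classic in (m I < +oo)%E ->
  (z - e) * fine (m I) <= fine (\int[m]_(t in I) t%:E)%E
    <= (z + e) * fine (m I).
Proof.
move=> I moo; set M := fine (m I).
have mI : measurable I by exact: measurable_itv.
have bnd (f : R -> R) : measurable_fun setT f -> [bounded f t | t in I] ->
    m.-integrable I (EFin \o f).
  move=> mf bf; apply: measurable_bounded_integrable => //.
  exact: measurable_funTS.
have icst (c : R) : m.-integrable I (EFin \o cst c).
  apply: bnd; first exact: measurable_cst.
  exists `|c|; split; first exact: num_real.
  by move=> y cy t _; exact: ltW.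
have iid : m.-integrable I (EFin \o idfun).
  apply: bnd; first exact: measurable_id.
  exists (`|z| + e); split; first exact: num_real.
  move=> y zy t; rewrite /I /= in_itv /= => /andP[t1 t2].
  apply: le_trans (ltW zy).
  rewrite ler_norml; apply/andP; split.
    by have := ler_norm (- z); rewrite normrN; lra.
  by have := ler_norm z; lra.
have mfin : m I \is a fin_num by rewrite ge0_fin_numE.
have cstE (c : R) : (\int[m]_(t in I) c%:E = (c * M)%:E)%E.
  by rewrite integral_cst// EFinM fineK.
have aE : (\int[m]_(t in I) t%:E = (fine (\int[m]_(t in I) t%:E)%E)%:E)%E.
  by rewrite fineK//; exact: (integrable_fin_num mI iid).
rewrite -!lee_fin -aE -!cstE; apply/andP; split; apply: le_integral => //.
- exact: (icst (z - e)).
- by move=> t; rewrite inE /I /= in_itv /= => /andP[t1 t2]; rewrite lee_fin ltW.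
- exact: (icst (z + e)).
- by move=> t; rewrite inE /I /= in_itv /= => /andP[t1 t2]; rewrite lee_fin ltW.
Qed.

End Resolution.

(** * Expansion in eigenvectors *)

Section SpectralGap.
Context d (T : measurableType d) (R : realType).
Variable mu : {measure set T -> \bar R}.
Local Notation C := (R[i]).
Implicit Types f g h u v w : T -> C.
Local Notation inner := (inner mu).
Local Notation L2 := (L2 mu).
Local Notation Re := complex.Re.
Variable E : set R -> (T -> C) -> T -> C.
Hypothesis pE : is_pvm mu E.
Implicit Types (B I : set R) (phi : R -> R).
Local Notation concentrated := (concentrated mu E).
Variable L : (T -> C) -> (T -> C) -> Prop.
Hypothesis LE : forall f g, L f g <-> spectral_integral mu E idfun f g.

(* By polarization, <(L - z) u, h> is a combination of integrals of t - z over
   the interval, where |t - z| < e. *)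
Lemma interval_form_bound (z e : R) u v h : 0 < e ->
  let I := `]z - e, z + e[%classic : set R in
  L u v -> L2 h -> concentrated h I ->
  Re (inner (fun x => v x - z%:C%C * u x) h) <=
    e / 2 * (Re (inner u u) + Re (inner h h)).
Proof.
move=> e0 I Luv Lh ch; have /LE[du Lv vE] := Luv; have [Lu _] := du.
have mI : measurable I by exact: measurable_itv.
have mid : measurable_fun setT (idfun : R -> R) by exact: measurable_id.
have Ib t : I t -> `|idfun t| <= `|z| + e.
  rewrite /I /= in_itv /= => /andP[t1 t2]; rewrite ler_norml.
  by have := ler_norm (- z); have := ler_norm z; rewrite normrN; lra.
have dh : spectral_domain mu E idfun h by exact: concentrated_domain Ib Lh ch.
pose w k x := u x + 'i%C ^+ k * h x.
have Lw k : L2 (w k).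
  by have := L2_lin ('i%C ^+ k) Lh Lu; rewrite /w; under eq_fun do rewrite addrC.
pose m k := Re (inner (E I (w k)) (w k)).
pose a k := fine (\int[spectral_measure mu E (w k)]_(t in I) t%:E)%E.
have abs_le k : `|a k - z * m k| <= e * m k.
  have := @integral_itv_bounds R (pvm_measure pE (Lw k)) z e
    (pvm_measure_lty pE (Lw k) mI).
  rewrite [X in fine X](pvm_measureE pE (Lw k) mI) -/(m k).
  rewrite -(integral_spectral_measure pE (Lw k)) -/(a k).
  by rewrite ler_norml; lra.
have m_le k : m k <= Re (inner (w k) (w k)).
  by rewrite -(pvm_setC pE mI (Lw k)) lerDl (pvm_ge0 pE)//; exact: measurableC.
have vhE : inner v h = 4^-1 * \sum_(k < 4) 'i%C ^+ k * (a k)%:C%C.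
  rewrite vE// (@spectral_form_localized _ _ _ _ _ pE I idfun (`|z| + e) u h u)//.
  by move=> k B mB IB; exact: (concentrated_agree_r pE _ mI).
have uhE : inner u h = 4^-1 * \sum_(k < 4) 'i%C ^+ k * (m k)%:C%C.
  by rewrite (pvm_polarization pE)// (concentrated_inner pE).
rewrite innerBl//; last exact: L2Z.
rewrite innerZl// vhE uhE mulrCA -mulrBr mulr_sumr -sumrB.
have -> : \sum_(k < 4)
      ('i%C ^+ k * (a k)%:C%C - z%:C%C * ('i%C ^+ k * (m k)%:C%C)) =
    \sum_(k < 4) 'i%C ^+ k * (a k - z * m k)%:C%C :> C.
  by apply: eq_bigr => k _; rewrite rmorphB rmorphM /= mulrBr mulrCA.
rewrite (sum4 (fun k => 'i%C ^+ k * (a k - z * m k)%:C%C)).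
have pw (c : C) := let: And4 h0 h1 h2 h3 := powi c in (h0, h1, h2, h3).
rewrite !pw.
have -> : (4^-1 : C) = (4^-1 : R)%:C%C by rewrite fmorphV rmorph_nat.
have := m_le 0%N; have := m_le 2%N; have := abs_le 0%N; have := abs_le 2%N.
(* The terms k = 1 and k = 3 are purely imaginary, so the real part only sees [w 0] = u + h and
   [w 2] = u - h; their norms are related by the parallelogram law. *)
have w0 : Re (inner (w 0%N) (w 0%N)) + Re (inner (w 2%N) (w 2%N)) =
    2 * Re (inner u u) + 2 * Re (inner h h).
  have N0 := pvm_normD pE ('i%C ^+ 0) measurableT Lu Lh.
  have N2 := pvm_normD pE ('i%C ^+ 2) measurableT Lu Lh.
  move: N0 N2; rewrite -/(w 0%N) -/(w 2%N) !(pvm_setT_norm pE)//.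
  move=> -> ->; rewrite !csq_powi.
  have [[_ i2] _] := pw 1; rewrite mulr1 in i2; rewrite i2 expr0 conjcN conjc1.
  by rewrite !mulNr !mul1r ReN; ring.
move: (a 0%N) (a 2%N) (m 0%N) (m 2%N) (a 1%N) (a 3%N) (m 1%N) (m 3%N) w0.
move: (Re (inner (w 0%N) (w 0%N))) (Re (inner (w 2%N) (w 2%N))).
move: (Re (inner u u)) (Re (inner h h)) => U H W0 W2 a0 a2 m0 m2 a1 a3 m1 m3 WE.
rewrite !ler_norml => /andP[A1 A2] /andP[B1 B2] M2 M0 /=.
have : (a0 - z * m0) - (a2 - z * m2) <= e * (W0 + W2).
  have := ler_wpM2l (ltW e0) M0; have := ler_wpM2l (ltW e0) M2; lra.
by rewrite WE; lra.
Qed.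

Lemma resolvent_gap (z : R) : resolvent_set mu L z%:C%C ->
  exists2 e : R, 0 < e &
    forall h, L2 h -> inner (E `]z - e, z + e[%classic h) h = 0.
Proof.
(* This e turns (e/2)(|u|^2 + |h|^2) <= (e/2)(M^2 + 1)|h|^2 into |h|^2 / 2, so |h|^2 <= |h|^2 / 2
   and h = 0. *)
move=> [surj [M bM]]; pose e := (M ^+ 2 + 1)^-1.
have M1 : 0 < M ^+ 2 + 1 by rewrite ltr_wpDl ?sqr_ge0.
have e0 : 0 < e by rewrite invr_gt0.
exists e => // h0 Lh0; set I := `]_, _[%classic.
have mI : measurable I by exact: measurable_itv.
rewrite (pvm_norm pE)//; pose h := E I h0; rewrite -/h.
have Lh : L2 h by exact: (pvm_L2 pE).
have ch : concentrated h I by exact: (pvm_concentrated pE).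
have [u [v [Luv uvh]]] := surj h Lh.
have /LE[[Lu _] Lv _] := Luv.
have Lvu : L2 (fun x => v x - z%:C%C * u x) by apply: L2B => //; exact: L2Z.
have := interval_form_bound e0 Luv Lh ch.
rewrite (inner_ae Lvu Lh Lh Lh uvh (aeW _ _))//.
have := bM u v Luv; rewrite !L2norm_sqrt// (inner_ae Lvu Lvu Lh Lh uvh uvh).
rewrite lee_fin.
have := Re_inner_ge0 mu u; have := Re_inner_ge0 mu h.
move=> H0 U0 sUH Hle.
suff : Re (inner h h) = 0 by move=> h00; rewrite innerE h00.
move: (Re (inner u u)) (Re (inner h h)) H0 U0 sUH Hle => U H H0 U0 sUH Hle.
have UH : U <= M ^+ 2 * H.
  rewrite -[U]sqr_sqrtr// -[H]sqr_sqrtr// -exprMn lerXn2r// nnegrE ?sqrtr_ge0//.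
  exact: le_trans (sqrtr_ge0 _) sUH.
have : e / 2 * (U + H) <= H / 2.
  rewrite (_ : H / 2 = e / 2 * ((M ^+ 2 + 1) * H)).
    by rewrite ler_pM2l ?divr_gt0//; lra.
  by rewrite /e; field; rewrite gt_eqF.
by move=> h2; apply/eqP; rewrite eq_le H0 andbT; lra.
Qed.

Variable lam : nat -> R.
Hypothesis lam_inj : injective lam.
Hypothesis gap : forall z : R, (forall k, z <> lam k) ->
  resolvent_set mu L z%:C%C.

(** The width of the gap depends on the point, so a countable cover is needed: [J] enumerates the
    intervals with rational endpoints that are null for the spectral measure of h, and is empty at
    every other code. Each point off the eigenvalues lies in one of them, inside its gap. *)
Lemma pvm_off_eigenvalues h : L2 h -> 
  inner (E (~` (\bigcup_k [set lam k])) h) h = 0.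
Proof.
move=> Lh; have mlam : measurable (\bigcup_k [set lam k]).
  by apply: bigcupT_measurable => k; exact: measurable_set1.
have mC := measurableC mlam.
suff : (pvm_measure pE Lh).-negligible (~` (\bigcup_k [set lam k])).
  move=> /(measure_negligible mC) m0; rewrite (pvm_real pE)//.
  suff -> : Re (inner (E (~` (\bigcup_k [set lam k])) h) h) = 0 by [].
  by apply: EFin_inj; rewrite -(pvm_measureE pE Lh mC).
pose J (n : nat) : set R := if unpickle n is Some (p, q) then
  let I := `](ratr p : R), ratr q[%classic in
  if `[< inner (E I h) h = 0 >] then I else set0 else set0.
apply: (@negligibleS _ _ _ _ (\bigcup_n J n)).
  move=> z nz; have [e e0 zE] : exists2 e : R, 0 < e &
    forall h, L2 h -> inner (E `]z - e, z + e[%classic h) h = 0.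
    by apply/resolvent_gap/gap => k zk; apply: nz; exists k.
  have ze : z - e < z by rewrite ltrBlDr ltrDl.
  have ez : z < z + e by rewrite ltrDl.
  have [p] := rat_in_itvoo ze; rewrite in_itv /= => /andP[p1 p2].
  have [q] := rat_in_itvoo ez; rewrite in_itv /= => /andP[q1 q2].
  exists (pickle (p, q)); first exact: I.
  rewrite /J pickleK; case: asboolP => [_|[]]; first by rewrite /= in_itv /= p2 q1.
  have mI : measurable (`](ratr p : R), ratr q[%classic) by exact: measurable_itv.
  have mI' : measurable `]z - e, z + e[%classic by exact: measurable_itv.
  rewrite (pvm_real pE)//; set a := Re _; suff -> : a = 0 by [].
  apply/eqP; rewrite eq_le (pvm_ge0 pE)// andbT.
  have <- : Re (inner (E `]z - e, z + e[%classic h) h) = 0 by rewrite zE.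
  rewrite -lee_fin -!(pvm_measureE pE Lh)//; apply: le_measure; rewrite ?inE//.
  by apply: subset_itvW; exact: ltW.
apply: negligible_bigcup => n; rewrite /J.
case: unpickle => [[p q]|]; last exact: negligible_set0.
case: asboolP => [h0|_]; last exact: negligible_set0.
apply/negligibleP; first exact: measurable_itv.
apply: etrans (pvm_measureE pE Lh _) _; first exact: measurable_itv.
by rewrite h0.
Qed.

Lemma eigen_expansion h : L2 h ->
  Re (inner (fun x => h x - \sum_(i < n) E [set lam i] h x)
            (fun x => h x - \sum_(i < n) E [set lam i] h x)) @[n --> \oo]
    --> (0 : R).
Proof.
move=> Lh; have mF n : measurable [set lam n] by exact: measurable_set1.
have mlam : measurable (\bigcup_k [set lam k]) by exact: bigcupT_measurable.
have tF : trivIset setT (fun k => [set lam k]).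
  by apply/trivIsetP => i j _ _ ij; apply/seteqP; split => // x [-> /lam_inj];
    move/eqP: ij.
have LU := pvm_L2 pE mlam Lh.
have LEi i : L2 (E [set lam i] h) by exact: (pvm_L2 pE).
(* The squared norm of the difference is the mass of the complement, which is 0. *)
have hE : E (\bigcup_k [set lam k]) h = h %[ae mu].
  have LUh := L2B LU Lh.
  apply/ae_eq_subr0/inner_eq0 => //; rewrite innerBl// !innerBr//.
  rewrite -(pvm_norm pE)// (innerC LU Lh) (pvm_real pE mlam Lh) (innerE mu h).
  rewrite -(pvm_setC pE mlam Lh) pvm_off_eigenvalues// addr0.
  by rewrite conjc_real !subrr.
have := pvm_sigma pE mF tF Lh.
rewrite (_ : (fun n => _) = EFin \o (fun n => Num.sqrt (Re (inner
    (fun x => h x - \sum_(i < n) E [set lam i] h x)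
    (fun x => h x - \sum_(i < n) E [set lam i] h x))))).
  move=> /fine_cvgP[_] /= s0.
  rewrite -[X in _ --> X](mulr0 0); apply: cvg_trans (cvgM s0 s0).
  apply: near_eq_cvg; near=> n.
  by rewrite /= -expr2 sqr_sqrtr// Re_inner_ge0.
apply/funext => n /=; have LS : L2 (fun x => \sum_(i < n) E [set lam i] h x).
  by apply: L2_sum => i.
have ae_h : (fun x => E (\bigcup_k [set lam k]) h x - \sum_(i < n) E [set lam i] h x)
    = (fun x => h x - \sum_(i < n) E [set lam i] h x) %[ae mu].
  by apply: filterS hE => x /(_ I) -> _.
rewrite L2norm_sqrt; last exact: L2B.
by rewrite (inner_ae (L2B LU LS) (L2B LU LS) (L2B Lh LS) (L2B Lh LS) ae_h ae_h).
Unshelve. all: by end_near. Qed.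

End SpectralGap.

(** * Eigenspaces as ranges of spectral projections, and Bessel's inequality *)

Section EigenProjections.
Context d (T : measurableType d) (R : realType).
Variable mu : {measure set T -> \bar R}.
Local Notation C := (R[i]).
Implicit Types f g h u v w : T -> C.
Local Notation inner := (inner mu).
Local Notation L2 := (L2 mu).
Local Notation Re := complex.Re.
Variable L : (T -> C) -> (T -> C) -> Prop.
Hypothesis saL : self_adjoint mu L.

Lemma self_adjoint_sym u v u' v' : L u v -> L u' v' -> inner v u' = inner u v'.
Proof. by case: saL => _ _ adj Luv /adj[_ _ H]; exact: H. Qed.

Lemma eigenspace_L2 z u : op_eigenspace L z u -> L2 u.
Proof. by case: saL => opL _ _ /(op_L2 opL)[]. Qed.

Lemma eigenspaceB z u v : op_eigenspace L z u -> op_eigenspace L z v ->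
  op_eigenspace L z (fun x => u x - v x).
Proof.
case: saL => opL _ _ zu zv.
have := op_lin opL (-1) zv zu; rewrite /op_eigenspace.
rewrite (_ : (fun x => -1 * v x + u x) = (fun x => u x - v x)); last first.
  by apply/funext => x; rewrite mulN1r addrC.
rewrite (_ : (fun x => -1 * (z * v x) + z * u x) =
  (fun x => z * (u x - v x)))//.
by apply/funext => x; rewrite mulN1r addrC mulrBr.
Qed.

Lemma eigenspace_orth (a b : R) u v : a != b ->
  op_eigenspace L a%:C%C u -> op_eigenspace L b%:C%C v -> inner u v = 0.
Proof.
move=> ab au bv; have := self_adjoint_sym au bv.
have [Lu Lv] := (eigenspace_L2 au, eigenspace_L2 bv).
rewrite innerZl// innerZr// conjc_real => /eqP; rewrite -subr_eq0 -mulrBl.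
rewrite -rmorphB mulf_eq0 => /orP[|/eqP//].
by rewrite -(rmorph0 (real_complex R)) => /eqP/complexI/eqP;
  rewrite subr_eq0 (negbTE ab).
Qed.

Variable E : set R -> (T -> C) -> T -> C.
Hypothesis pE : is_pvm mu E.
Hypothesis LE : forall f g, L f g <-> spectral_integral mu E idfun f g.
Variable lam : nat -> R.
Hypothesis lam_inj : injective lam.
Hypothesis gap : forall z : R, (forall k, z <> lam k) ->
  resolvent_set mu L z%:C%C.

(** For i != j the vector [E [set lam i] u] is an eigenvector for another eigenvalue, hence
    orthogonal to u; but its inner product with u is its own squared norm, so it is null. In the
    expansion of u only the term j survives. *)
Lemma eigenvector_concentrated j u : op_eigenspace L (lam j)%:C%C u ->
  concentrated mu E u [set lam j].
Proof.
move=> ju; have Lu := eigenspace_L2 ju.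
have ml i : measurable [set lam i] by exact: measurable_set1.
have LEi i : L2 (E [set lam i] u) by exact: (pvm_L2 pE).
have E0 : {ae mu, forall x, forall i, i != j -> E [set lam i] u x = 0}.
  apply: ae_foralln => i; have [->|ij] := eqVneq i j; first exact: aeW.
  have : E [set lam i] u = cst 0 %[ae mu].
    apply: inner_eq0 => //; rewrite -(pvm_norm pE)//.
    apply: eigenspace_orth ju; last exact: (eigenspace_pvm pE LE).
    by rewrite inj_eq.
  by apply: filterS => x /(_ I) -> _.
have LuE := L2B Lu (LEi j).
suff : inner (fun x => u x - E [set lam j] u x)
             (fun x => u x - E [set lam j] u x) = 0.
  by move=> /(inner_eq0 LuE)/ae_eq_subr0/ae_eq_sym.
rewrite innerE; set c := Re _; suff -> : c = 0 by [].
(* As soon as n > j the n-th remainder of the expansion has squared norm c, so the limit 0 is c. *)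
have c0 : c @[_ --> \oo] --> (0 : R).
  apply: cvg_trans (eigen_expansion pE LE lam_inj gap Lu).
  apply: near_eq_cvg; near=> n.
  have LS : L2 (fun x => \sum_(i < n) E [set lam i] u x) by apply: L2_sum => i.
  have aeS : (fun x => u x - \sum_(i < n) E [set lam i] u x) =
      (fun x => u x - E [set lam j] u x) %[ae mu].
    apply: filterS E0 => x Ex _; congr (_ - _).
    have jn : (j < n)%N by near: n; exists j.+1.
    rewrite (bigD1 (Ordinal jn))//= big1 ?addr0// => i ij.
    by apply: Ex; apply: contra ij => /eqP ij; apply/eqP/val_inj.
  by rewrite (inner_ae (L2B Lu LS) (L2B Lu LS) LuE LuE aeS aeS).
by move/(cvg_lim (@Rhausdorff R)): c0; rewrite lim_cst.
Unshelve. all: by end_near. Qed.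

(** The difference w of the two candidates is itself an eigenvector, and f minus either candidate is
    orthogonal to w; hence so is w. *)
Lemma eigenprojection_pvm k f p : L2 f ->
  is_eigenprojection mu L (lam k)%:C%C f p -> p = E [set lam k] f %[ae mu].
Proof.
move=> Lf [kp pf]; have Lp := eigenspace_L2 kp.
have ml : measurable [set lam k] by exact: measurable_set1.
have LEf : L2 (E [set lam k] f) by exact: (pvm_L2 pE).
have kw := eigenspaceB kp (eigenspace_pvm pE LE (lam k) Lf).
have Lw := L2B Lp LEf.
apply/ae_eq_subr0/inner_eq0 => //.
have := pf _ kw; rewrite innerBl// => fp.
rewrite innerBl//; set w := (fun x => p x - E [set lam k] f x) in kw Lw fp *.
rewrite (concentrated_inner pE ml Lw Lf (eigenvector_concentrated kw)).
by rewrite -opprB fp oppr0.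
Qed.

(** Unnormalized Bessel inequality: [c k] times [p k] is the component of g along [p k], so there is
    no division by |p_k|^2, which may be 0. Each component removed from g lowers the squared norm by
    exactly its own. *)
Lemma bessel (p : nat -> T -> C) (c : nat -> R) g n : L2 g ->
  (forall k, L2 (p k)) -> (forall i j, i != j -> inner (p i) (p j) = 0) ->
  (forall k, inner g (p k) = (c k)%:C%C * inner (p k) (p k)) ->
  \sum_(k < n) (c k) ^+ 2 * Re (inner (p k) (p k)) <= Re (inner g g).
Proof.
move=> Lg Lp orth gp.
pose G n x := g x - \sum_(k < n) (c k)%:C%C * p k x.
have LS m : L2 (fun x => \sum_(k < m) (c k)%:C%C * p k x).
  by apply: L2_sum => k; exact: L2Z.
have LG m : L2 (G m) by exact: L2B.
suff GE m : Re (inner (G m) (G m)) =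
    Re (inner g g) - \sum_(k < m) (c k) ^+ 2 * Re (inner (p k) (p k)).
  by rewrite -subr_ge0 -GE Re_inner_ge0.
elim: m => [|m IH].
  rewrite big_ord0 subr0; congr (Re (inner _ _));
    by apply/funext => x; rewrite /G big_ord0 subr0.
have GS : G m.+1 = (fun x => (- (c m)%:C%C) * p m x + G m x).
  by apply/funext => x; rewrite /G big_ord_recr /= opprD addrA mulNr addrC.
have Gp : inner (G m) (p m) = (c m)%:C%C * inner (p m) (p m).
  rewrite innerBl// inner_suml//; last by move=> k; exact: L2Z.
  rewrite big1 ?subr0// => k _; rewrite innerZl// orth ?mulr0//.
  by rewrite neq_ltn ltn_ord.
rewrite GS inner_linl//; last exact: L2_lin.
rewrite !inner_linr// (innerC (LG m) (Lp m)) Gp (innerE mu (p m)).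
rewrite [in RHS]big_ord_recr.
rewrite -[X in _ = _ - X]/(\sum_(k < m) c k ^+ 2 * Re (inner (p k) (p k))
  + c m ^+ 2 * Re (inner (p m) (p m))) opprD
  [RHS]addrA -IH.
by move: (inner (G m) (G m)) (Re (inner (p m) (p m))) => [a b] N /=; ring.
Qed.

End EigenProjections.

(** * The Rademacher-Menshov inequality *)

Section EIntegral.
Context d (T : measurableType d) (R : realType).
Variable mu : {measure set T -> \bar R}.
Import HBNNSimple.

(** The integral of a nonnegative function is a supremum over the simple functions below it, hence
    monotone without measurability. It serves for the maximal function cut off to K. *)
Lemma ge0_le_integral_nonmeasurable (f g : T -> \bar R) :
  (forall x, (0 <= f x)%E) -> (forall x, (f x <= g x)%E) ->
  (\int[mu]_x f x <= \int[mu]_x g x)%E.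
Proof.
move=> f0 fg; rewrite !ge0_integralTE//; last by move=> x; exact: le_trans (fg x).
apply: ereal_sup_le => _ [h hf <-]; exists h => // x.
exact: le_trans (hf x) (fg x).
Qed.

End EIntegral.

Section RademacherMenshov.
Context d (T : measurableType d) (R : realType).
Variable mu : {measure set T -> \bar R}.
Local Notation C := (R[i]).
Local Notation inner := (inner mu).
Local Notation L2 := (L2 mu).
Local Notation Re := complex.Re.
Variable p : nat -> T -> C.

Definition block (s n : nat) x : C := \sum_(s <= k < s + n) p k x.

(** Sum of the squared moduli of the blocks over all dyadic subintervals of [s, s + 2^m), that is,
    over all nodes of a binary tree with m + 1 levels. *)
Fixpoint dyadic_sum (m s : nat) x : R :=
  if m is m'.+1 then dyadic_sum m' s x + dyadic_sum m' (s + 2 ^ m')%N x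
    + csq (block s (2 ^ m)%N x)
  else csq (p s x).

Lemma dyadic_sum_ge0 m s x : 0 <= dyadic_sum m s x.
Proof.
elim: m s => [|m IH] s /=; first exact: csq_ge0.
by apply: addr_ge0; [exact: addr_ge0|exact: csq_ge0]. Qed.

Lemma block0 s x : block s 0 x = 0.
Proof. by rewrite /block addn0 big_geq. Qed.

Lemma block1 s x : block s 1 x = p s x.
Proof. by rewrite /block addn1 big_nat1. Qed.

Lemma blockD s n m x : block s (n + m) x = block s n x + block (s + n) m x.
Proof. by rewrite /block addnA; apply: big_cat_nat; lia. Qed.

Lemma csq_block_dyadic_sum m s x : csq (block s (2 ^ m) x) <= dyadic_sum m s x.
Proof.
case: m => [|m] /=; first by rewrite expn0 block1.
by rewrite lerDr addr_ge0 ?dyadic_sum_ge0.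
Qed.

(** By its binary digits, a prefix is a union of dyadic intervals, at most one per level, and
    Cauchy-Schwarz over m + 1 levels gives the factor. In the induction a prefix longer than the
    first half is that half, with weight 1, plus a prefix of the second, with weight m + 1. *)
Lemma csq_block_le m s n x : (n <= 2 ^ m)%N ->
  csq (block s n x) <= m.+1%:R * dyadic_sum m s x.
Proof.
elim: m s n => [|m IH] s n.
  rewrite expn0 mul1r; case: n => [_|[_|//]]; last by rewrite block1.
  by rewrite block0 csq0 csq_ge0.
move=> nm /=; set Q1 := dyadic_sum m s x; set Q2 := dyadic_sum m _ x.
have Q1_ge0 : 0 <= Q1 by exact: dyadic_sum_ge0.
have Q2_ge0 : 0 <= Q2 by exact: dyadic_sum_ge0.
have c0 := csq_ge0 (block s (2 ^ m.+1) x).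
have [nle|nlt] := leqP n (2 ^ m).
  apply: le_trans (IH _ _ nle) _; rewrite -/Q1.
  by apply: ler_pM => //; [rewrite ler_nat|lra].
rewrite -(subnKC (ltnW nlt)) blockD.
have n'm : (n - 2 ^ m <= 2 ^ m)%N by rewrite expnS in nm; lia.
have m0 : (0 : R) < m.+1%:R by rewrite ltr0n.
apply: le_trans (csqD_weighted _ _ ltr01 m0) _.
rewrite [1 + _]addrC natr1 ler_pM2l ?ltr0n// divr1.
have h1 := csq_block_dyadic_sum m s x.
have h2 : csq (block (s + 2 ^ m) (n - 2 ^ m) x) / m.+1%:R <= Q2.
  by rewrite ler_pdivrMr// mulrC; exact: IH.
by apply: le_trans (lerD h1 h2) _; rewrite lerDl.
Qed.

(** The shift by 1 lets the blocks of length 2^j tile the indices from 0; block j consists of the k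
    with [trunc_log 2 k.+1] = j. *)
Definition dyadic_start j := (2 ^ j - 1)%N.

(** The first summand controls partial sums ending at a block boundary, the second those ending
    inside block j. A factor 2 in each comes from |x + y|^2 <= 2|x|^2 + 2|y|^2; the other 2 in the
    first bounds 2 - 1/(j + 1) in [csq_dyadic_le]. *)
Definition menshov_term (j : nat) x : R :=
  4 * (j.+1%:R * j.+2%:R) * csq (block (dyadic_start j) (2 ^ j) x)
  + 2 * j.+1%:R * dyadic_sum j (dyadic_start j) x.

Lemma menshov_term_ge0 j x : 0 <= menshov_term j x.
Proof. by rewrite addr_ge0 ?mulr_ge0 ?csq_ge0 ?dyadic_sum_ge0. Qed.

Lemma block_dyadic_start j x :
  block 0 (dyadic_start j) x = \sum_(i < j) block (dyadic_start i) (2 ^ i) x.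
Proof.
elim: j => [|j IH]; first by rewrite big_ord0 block0.
rewrite big_ord_recr /= -IH -[X in block X (2 ^ j) x]add0n -blockD.
by congr block; rewrite /dyadic_start expnS; have := expn_gt0 2 j; lia.
Qed.

(* The weights 1/((i+1)(i+2)) sum to 1 - 1/(j+1), which telescopes in the
   induction; the extra 1 keeps the constant positive at j = 0. *)
Lemma csq_dyadic_le j x : csq (block 0 (dyadic_start j) x) <=
  (2 - j.+1%:R^-1) *
  \sum_(i < j) i.+1%:R * i.+2%:R * csq (block (dyadic_start i) (2 ^ i) x).
Proof.
rewrite block_dyadic_start; elim: j => [|j IH].
  by rewrite !big_ord0 mulr0 csq0.
rewrite !big_ord_recr /=; set H := (\sum_(i < j) _ * _ * _) in IH *.
set y := block _ _ _.
have j1 : (0 : R) < j.+1%:R by rewrite ltr0n.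
have j2 : (0 : R) < j.+2%:R by rewrite ltr0n.
have s0 : 0 < 2 - (j.+1%:R : R)^-1.
  by rewrite subr_gt0; apply: le_lt_trans (_ : 1 < 2); rewrite ?invf_le1 ?ler1n ?ltr1n.
have t0 : 0 < ((j.+1%:R : R) * j.+2%:R)^-1 by rewrite invr_gt0 mulr_gt0.
apply: le_trans (csqD_weighted _ _ s0 t0) _.
have -> : 2 - (j.+1%:R : R)^-1 + (j.+1%:R * j.+2%:R)^-1 = 2 - j.+2%:R^-1.
  have e2 : (j.+2%:R : R) = j.+1%:R + 1 by rewrite -natr1.
  rewrite e2; move: (j.+1%:R : R) j1 => b b0.
  by field; rewrite !gt_eqF// addr_gt0.
rewrite invrK ler_pM2l; last first.
  by rewrite subr_gt0; apply: le_lt_trans (_ : 1 < 2); rewrite ?invf_le1 ?ler1n ?ltr1n.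
rewrite [leRHS]addrC [leLHS]addrC mulrC lerD2l.
by rewrite ler_pdivrMr// mulrC.
Qed.

(** The completed blocks are separated from the prefix of length r in block j. The bound is free of
    r and grows with j, so the full series dominates every partial sum. *)
Lemma csq_partial_le j r x : (r <= 2 ^ j)%N ->
  csq (block 0 (dyadic_start j + r) x) <= \sum_(i < j.+1) menshov_term i x.
Proof.
move=> rj; rewrite blockD add0n; apply: le_trans (csqD_le _ _) _.
have h1 := csq_dyadic_le j x; have h2 := csq_block_le (dyadic_start j) x rj.
rewrite /menshov_term big_split /=.
set H := \sum_(i < j) _ in h1.
have H0 : 0 <= H by apply: sumr_ge0 => i _; rewrite !mulr_ge0 ?csq_ge0 ?ler0n.
have H1 : csq (block 0 (dyadic_start j) x) <= 2 * H.
  apply: le_trans h1 _; rewrite ler_wpM2r// gerBl.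
  by rewrite invr_ge0.
rewrite big_ord_recr /= [X in _ <= _ + X]big_ord_recr /=.
have -> : \sum_(i < j) 4 * (i.+1%:R * i.+2%:R) *
    csq (block (dyadic_start i) (2 ^ i) x) = 4 * H.
  by rewrite mulr_sumr; apply: eq_bigr => i _; rewrite -mulrA.
have : 0 <= 4 * (j.+1%:R * j.+2%:R) * csq (block (dyadic_start j) (2 ^ j) x).
  by rewrite !mulr_ge0 ?csq_ge0 ?ler0n.
have : 0 <= \sum_(i < j) 2 * i.+1%:R * dyadic_sum i (dyadic_start i) x.
  by apply: sumr_ge0 => i _; rewrite !mulr_ge0 ?dyadic_sum_ge0 ?ler0n.
by rewrite -[2 * _ * _]mulrA; lra.
Qed.

End RademacherMenshov.

(** * Integrals of the dyadic majorants of an orthogonal series *)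

Section RademacherMenshovIntegral.
Context d (T : measurableType d) (R : realType).
Variable mu : {measure set T -> \bar R}.
Local Notation C := (R[i]).
Local Notation inner := (inner mu).
Local Notation L2 := (L2 mu).
Local Notation Re := complex.Re.
Variable p : nat -> T -> C.
Hypothesis Lp : forall k, L2 (p k).
Hypothesis orth : forall i j, i != j -> inner (p i) (p j) = 0.

Let N2 k : R := Re (inner (p k) (p k)).

Let N2_ge0 k : 0 <= N2 k. Proof. exact: Re_inner_ge0. Qed.

Lemma L2_block s n : L2 (block p s n).
Proof. exact: L2_sum. Qed.

Lemma measurable_csq_block s n :
  measurable_fun setT (fun x => csq (block p s n x)).
Proof. by have [? ? _] := L2_block s n; exact: measurable_csq. Qed.

Lemma inner_block s n : Re (inner (block p s n) (block p s n)) =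
  \sum_(s <= k < s + n) N2 k.
Proof.
elim: n => [|n IH].
  rewrite addn0 big_geq// (_ : block p s 0 = cst 0) ?inner0l//.
  by apply/funext => x; exact: block0.
have -> : block p s n.+1 = (fun x => block p s n x + p (s + n)%N x).
  by apply/funext => x; rewrite -addn1 blockD block1.
have Lb := L2_block s n.
have b0 : inner (block p s n) (p (s + n)%N) = 0.
  rewrite inner_suml// big_nat big1// => k /andP[_ ksn].
  by rewrite orth// neq_ltn ksn.
rewrite innerDl// ?innerDr//; last exact: L2D.
rewrite (innerC Lb (Lp _)) b0 conjc0 add0r addr0 ReD IH addnS.
by rewrite [RHS]big_nat_recr// leq_addr.
Qed.

Lemma integral_csq_block s n :
  (\int[mu]_x (csq (block p s n x))%:E = (\sum_(s <= k < s + n) N2 k)%:E)%E.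
Proof. by rewrite inner_normE ?inner_block//; exact: L2_block. Qed.

Lemma measurable_dyadic_sum m s : measurable_fun setT (dyadic_sum p m s).
Proof.
elim: m s => [|m IH] s.
  by have [? ? _] := Lp s; exact: measurable_csq.
exact: measurable_funD (measurable_funD (IH _) (IH _))
  (measurable_csq_block _ _).
Qed.

(** Each of the m + 1 levels of the tree partitions [s, s + 2^m), so by orthogonality each
    contributes the same total. *)
Lemma integral_dyadic_sum m s : (\int[mu]_x (dyadic_sum p m s x)%:E =
  (m.+1%:R * \sum_(s <= k < s + 2 ^ m) N2 k)%:E)%E.
Proof.
elim: m s => [|m IH] s.
  rewrite mul1r -integral_csq_block; apply: eq_integral => x _ /=.
  by rewrite expn0 block1.
have D0 n t x : (0 <= (dyadic_sum p n t x)%:E)%E.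
  by rewrite lee_fin dyadic_sum_ge0.
have mD n t : measurable_fun setT (EFin \o dyadic_sum p n t).
  by apply/measurable_EFinP; exact: measurable_dyadic_sum.
have mb : measurable_fun setT (fun x => (csq (block p s (2 ^ m.+1) x))%:E).
  by apply/measurable_EFinP; exact: measurable_csq_block.
have b0 x : (0 <= (csq (block p s (2 ^ m.+1) x))%:E)%E.
  by rewrite lee_fin csq_ge0.
have -> : (\int[mu]_x (dyadic_sum p m.+1 s x)%:E =
  \int[mu]_x ((dyadic_sum p m s x)%:E + (dyadic_sum p m (s + 2 ^ m) x)%:E
    + (csq (block p s (2 ^ m.+1) x))%:E))%E.
  by apply: eq_integral => x _; rewrite -!EFinD.
rewrite ge0_integralD//; last 2 first.
- by move=> x _; rewrite adde_ge0.
- exact: emeasurable_funD (mD _ _) (mD _ _).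
rewrite ge0_integralD//; [|exact: mD|exact: mD].
rewrite !IH integral_csq_block -!EFinD; congr EFin.
have -> : \sum_(s <= k < s + 2 ^ m.+1) N2 k =
    \sum_(s <= k < s + 2 ^ m) N2 k + \sum_(s + 2 ^ m <= k < s + 2 ^ m + 2 ^ m) N2 k.
  by rewrite expnS mul2n -addnn addnA; apply: big_cat_nat; lia.
by rewrite -[m.+2%:R]natr1; ring.
Qed.

Lemma measurable_menshov_term j : measurable_fun setT (menshov_term p j).
Proof.
exact: measurable_funD
  (measurable_funM (measurable_cst _) (measurable_csq_block _ _))
  (measurable_funM (measurable_cst _) (measurable_dyadic_sum _ _)).
Qed.

Lemma integral_menshov_term j : (\int[mu]_x (menshov_term p j x)%:E <=
  (10 * \sum_(dyadic_start j <= k < dyadic_start j + 2 ^ j)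
     (trunc_log 2 k.+1).+1%:R ^+ 2 * N2 k)%:E)%E.
Proof.
pose c1 : R := 4 * (j.+1%:R * j.+2%:R); pose c2 : R := 2 * j.+1%:R.
have [c1_ge0 c2_ge0] : 0 <= c1 /\ 0 <= c2 by split; rewrite !mulr_ge0.
have mb : measurable_fun setT
    (fun x => (csq (block p (dyadic_start j) (2 ^ j) x))%:E).
  by apply/measurable_EFinP; exact: measurable_csq_block.
have mq : measurable_fun setT (fun x => (dyadic_sum p j (dyadic_start j) x)%:E).
  by apply/measurable_EFinP; exact: measurable_dyadic_sum.
have b0 x : (0 <= (csq (block p (dyadic_start j) (2 ^ j) x))%:E)%E.
  by rewrite lee_fin csq_ge0.
have q0 x : (0 <= (dyadic_sum p j (dyadic_start j) x)%:E)%E.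
  by rewrite lee_fin dyadic_sum_ge0.
have -> : (\int[mu]_x (menshov_term p j x)%:E =
  \int[mu]_x (c1%:E * (csq (block p (dyadic_start j) (2 ^ j) x))%:E
    + c2%:E * (dyadic_sum p j (dyadic_start j) x)%:E))%E.
  by apply: eq_integral => x _; rewrite -!EFinM -EFinD.
rewrite ge0_integralD//; last 4 first.
- by move=> x _; rewrite mule_ge0.
- exact: measurable_funeM.
- by move=> x _; rewrite mule_ge0.
- exact: measurable_funeM.
rewrite !ge0_integralZl_EFin// integral_csq_block integral_dyadic_sum.
rewrite -!EFinM -EFinD lee_fin.
have -> : \sum_(dyadic_start j <= k < dyadic_start j + 2 ^ j)
     (trunc_log 2 k.+1).+1%:R ^+ 2 * N2 k =
   j.+1%:R ^+ 2 * \sum_(dyadic_start j <= k < dyadic_start j + 2 ^ j) N2 k.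
  rewrite mulr_sumr; apply: eq_big_nat => k; rewrite /dyadic_start => kj.
  rewrite (@trunc_log_eq 2 j)// expnS; have := expn_gt0 2 j; lia.
set S := \sum_(_ <= k < _) N2 k.
have S0 : 0 <= S by apply: sumr_ge0.
rewrite /c1 /c2 -[j.+2%:R]natr1.
have : (1 : R) <= j.+1%:R by rewrite ler1n.
move: (j.+1%:R : R) => b b1.
(* With b = j + 1 the integral is (4 b (b + 1) + 2 b^2) S, at most 10 b^2 S because b >= 1; this is
   the origin of the constant 10. *)
rewrite -subr_ge0 (_ : _ - _ = 4 * b * (b - 1) * S); last by ring.
by rewrite !mulr_ge0//; lra.
Qed.


Lemma rademacher_menshov (B : R) :
  (forall n, \sum_(k < n) (trunc_log 2 k.+1).+1%:R ^+ 2 * N2 k <= B) ->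
  exists W : T -> \bar R, [/\ measurable_fun setT W,
    forall x, (0 <= W x)%E,
    forall n x, ((csq (\sum_(k < n) p k x))%:E <= W x)%E &
    (\int[mu]_x W x <= (10 * B)%:E)%E].
Proof.
move=> hB.
have m0 j x : (0 <= (menshov_term p j x)%:E)%E.
  by rewrite lee_fin menshov_term_ge0.
have mm j : measurable_fun setT (EFin \o menshov_term p j).
  by apply/measurable_EFinP; exact: measurable_menshov_term.
exists (fun x => \sum_(j <oo) (menshov_term p j x)%:E)%E; split.
- by apply: (@ge0_emeasurable_sum _ _ _ _ _ xpredT) => // k _; exact: mm.
- by move=> x; exact: nneseries_ge0.
(* With this j, n lies in [2^j - 1, 2^(j+1) - 1): a block start plus a prefix of length n + 1 -
   2^j. *)
- move=> n x; set j := trunc_log 2 n.+1.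
  have /andP[n1 n2] : (2 ^ j <= n.+1 < 2 ^ j.+1)%N by exact: trunc_log_bounds.
  rewrite expnS in n2; have nE : n = (dyadic_start j + (n.+1 - 2 ^ j))%N.
    by rewrite /dyadic_start; have := expn_gt0 2 j; lia.
  apply: (@le_trans _ _ (\sum_(0 <= i < j.+1) (menshov_term p i x)%:E)%E).
    rewrite sumEFin lee_fin big_mkord.
    have -> : \sum_(k < n) p k x = block p 0 n x by rewrite /block big_mkord.
    rewrite {1}nE; apply: csq_partial_le; lia.
  by apply: nneseries_lim_ge => i _ _; exact: m0.
(* The first J blocks tile the indices below 2^J - 1, so the bounds on single blocks add up to a
   partial sum bounded by B. *)
- have bE J : \sum_(0 <= j < J)
      \sum_(dyadic_start j <= k < dyadic_start j + 2 ^ j)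
        (trunc_log 2 k.+1).+1%:R ^+ 2 * N2 k =
      \sum_(k < dyadic_start J) (trunc_log 2 k.+1).+1%:R ^+ 2 * N2 k.
    elim: J => [|J IH]; first by rewrite big_geq// big_ord0.
    rewrite big_nat_recr//= IH -!(big_mkord xpredT (fun k =>
      (trunc_log 2 k.+1).+1%:R ^+ 2 * N2 k)) -big_cat_nat//; last first.
      exact: leq_addr.
    by congr (\sum_(0 <= k < _) _); rewrite /dyadic_start expnS;
      have := expn_gt0 2 J; lia.
  rewrite integral_nneseries//.
  apply: lime_le.
    by apply: is_cvg_nneseries => j _ _; apply: integral_ge0 => x _; exact: m0.
  near=> J; apply: (@le_trans _ _ (\sum_(0 <= j < J)
    (10 * \sum_(dyadic_start j <= k < dyadic_start j + 2 ^ j)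
     (trunc_log 2 k.+1).+1%:R ^+ 2 * N2 k)%:E)%E).
    by apply: lee_sum => j _; exact: integral_menshov_term.
  rewrite sumEFin lee_fin -mulr_sumr ler_pM2l//.
  by rewrite bE; exact: hB.
Unshelve. all: by end_near. Qed.

End RademacherMenshovIntegral.

(** * Almost everywhere convergence of orthogonal series *)

Section OrthogonalSeries.
Context d (T : measurableType d) (R : realType).
Variable mu : {measure set T -> \bar R}.
Local Notation C := (R[i]).
Local Notation inner := (inner mu).
Local Notation L2 := (L2 mu).
Local Notation Re := complex.Re.

Lemma bounded_series_tail (u : nat -> R) (B : R) : (forall k, 0 <= u k) ->
  (forall n, \sum_(k < n) u k <= B) -> forall e : R, 0 < e ->
  exists N0, forall N n, (N0 <= N)%N -> \sum_(k < n | (N <= k)%N) u k <= e.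
Proof.
move=> u0 uB e e0; pose S := [set \sum_(k < n) u k | n in setT].
have hS : has_sup S.
  by split; [exists (\sum_(k < 0) u k); exists 0%N|exists B => _ [n _ <-]].
have [_ [N0 _ <-] hN0] := sup_adherent e0 hS.
exists N0 => N n N0N.
have [nN|Nn] := leqP n N.
  rewrite big1 ?ltW// => k Nk; exfalso.
  by have := leq_trans (leq_trans (ltn_ord k) nN) Nk; rewrite ltnn.
have : \sum_(k < n) u k <= sup S by apply: ub_le_sup; [case: hS|exists n].
rewrite (bigID (fun k : 'I_n => (N <= k)%N)) /=.
suff : \sum_(k < N0) u k <= \sum_(k < n | ~~ (N <= k)%N) u k by lra.
rewrite -(big_mkord xpredT u) -(big_mkord (fun k => ~~ (N <= k)%N) u).
rewrite (@big_cat_nat _ _ _ N0 0 n)//=; last exact: leq_trans (ltnW Nn).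
rewrite [X in _ <= X + _](_ : _ = \sum_(0 <= k < N0) u k).
  by rewrite lerDl; apply: sumr_ge0.
rewrite [LHS]big_nat_cond [RHS]big_nat_cond; apply: eq_bigl => k.
by rewrite -ltnNge; lia.
Qed.

(** Take majorants G_i of integral at most 1/(i + 1). Their infimum has integral 0, so it vanishes
    almost everywhere; at such a point every e > 0 exceeds some G_i, which gives P at e. *)
Lemma ae_small_of_integral (P : T -> R -> Prop) :
  (forall x e e', P x e -> e <= e' -> P x e') ->
  (forall e : R, 0 < e -> exists G : T -> \bar R,
     [/\ measurable_fun setT G, forall x, (0 <= G x)%E,
         (\int[mu]_x G x <= e%:E)%E & forall x r, (G x < r%:E)%E -> P x r]) ->
  {ae mu, forall x, forall e, 0 < e -> P x e}.
Proof.
move=> Pmono H.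
have /choice[G HG] : forall i : nat, exists G : T -> \bar R,
     [/\ measurable_fun setT G, forall x, (0 <= G x)%E,
         (\int[mu]_x G x <= (i.+1%:R^-1)%:E)%E &
         forall x r, (G x < r%:E)%E -> P x r].
  by move=> i; apply: H; rewrite invr_gt0 ltr0n.
pose I x := einfs (G^~ x) 0%N.
have IG i x : (I x <= G i x)%E by apply: ereal_inf_lbound; exists i.
have I0 x : (0 <= I x)%E.
  by apply: le_ereal_inf_tmp => _ [i _ <-]; have [_ + _ _] := HG i; exact.
have mI : measurable_fun setT I.
  by apply: measurable_fun_einfs => i; have [] := HG i.
have intI : (\int[mu]_x I x = 0)%E.
  apply/eqP; rewrite eq_le integral_ge0// andbT.
  apply/lee_addgt0Pr => e e0; rewrite add0e.
  have [i ie] : exists i : nat, i.+1%:R^-1 < e.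
    exists (Num.bound e^-1); rewrite invf_plt ?posrE ?ltr0n//.
    apply: lt_le_trans (archi_boundP _) _; first by rewrite invr_ge0 ltW.
    by rewrite ler_nat.
  have [mG _ iG _] := HG i.
  apply: (@le_trans _ _ (\int[mu]_x G i x)%E).
    exact: ge0_le_integral_nonmeasurable.
  by apply: le_trans iG _; rewrite lee_fin ltW.
have : ae_eq mu setT I (cst 0%E).
  apply/ae_eq_integral_abs => //; rewrite -[RHS]intI.
  by apply: eq_integral => x _; rewrite gee0_abs.
apply: filterS => x /(_ Logic.I) Ix0 e e0.
have : (I x < e%:E)%E by rewrite Ix0 lte_fin.
move=> /ereal_inf_lt[_ [i _ <-]] Gie.
by have [_ _ _ GP] := HG i; exact: GP.
Qed.

(** For n >= N the error is at most twice |f - S_N|^2 plus twice the maximal function of the series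
    started at N. The first has small integral by convergence in L2, the second by the maximal
    inequality for the tail. *)
Lemma orthogonal_series_ae_cvg (p : nat -> T -> C) f (B : R) :
  (forall k, L2 (p k)) -> (forall i j, i != j -> inner (p i) (p j) = 0) ->
  L2 f ->
  Re (inner (fun x => f x - \sum_(k < n) p k x)
            (fun x => f x - \sum_(k < n) p k x)) @[n --> \oo] --> (0 : R) ->
  (forall n, \sum_(k < n)
     (trunc_log 2 k.+1).+1%:R ^+ 2 * Re (inner (p k) (p k)) <= B) ->
  {ae mu, forall x, forall e : R, 0 < e ->
     exists N, forall n, (N <= n)%N -> csq (f x - \sum_(k < n) p k x) <= e}.
Proof.
move=> Lp orth Lf fS hB.
apply: ae_small_of_integral.
  by move=> x e e' [N HN] ee'; exists N => n /HN/le_trans; exact.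
move=> e e0; pose u k := (trunc_log 2 k.+1).+1%:R ^+ 2 * Re (inner (p k) (p k)).
have u0 k : 0 <= u k by rewrite mulr_ge0 ?sqr_ge0 ?Re_inner_ge0.
(* The budget is 2 (e/4) + 2 * 10 (e/40) = e, where 10 is the Rademacher-Menshov constant. *)
have e40 : 0 < e / 40 by rewrite divr_gt0.
have [N0 tail] := bounded_series_tail u0 hB e40.
have e4 : 0 < e / 4 by rewrite divr_gt0.
have [N [N0N fN]] : exists N, (N0 <= N)%N /\
    Re (inner (fun x => f x - \sum_(k < N) p k x)
              (fun x => f x - \sum_(k < N) p k x)) <= e / 4.
  have [N1 _ HN1] := cvgr0_norm_le _ fS _ e4.
  exists (maxn N0 N1); split; first exact: leq_maxl.
  by apply: le_trans (ler_norm _) (HN1 _ _); rewrite /= leq_maxr.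
(* Replacing the first N terms by 0 instead of reindexing keeps the logarithmic weights of the tail
   unchanged. *)
pose q k : T -> C := if (N <= k)%N then p k else cst 0.
have Lq k : L2 (q k) by rewrite /q; case: ifP => // _; exact: L2_cst0.
have orthq i j : i != j -> inner (q i) (q j) = 0.
  move=> ij; rewrite /q; case: ifP => _; last exact: inner0l.
  case: ifP => _; first exact: orth.
  by rewrite (innerC (L2_cst0 mu) (Lp i)) inner0l conjc0.
have qB n : \sum_(k < n) (trunc_log 2 k.+1).+1%:R ^+ 2 * Re (inner (q k) (q k))
    <= e / 40.
  apply: le_trans (tail N n N0N); rewrite [leRHS]big_mkcond.
  apply: ler_sum => k _; rewrite /q; case: ifP => // _.
  by rewrite inner0l mulr0.
have [W [mW W0 qW intW]] := rademacher_menshov Lq orthq qB.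
have LS : L2 (fun x => f x - \sum_(k < N) p k x).
  by apply: L2B => //; exact: L2_sum.
have mS : measurable_fun setT (fun x => (csq (f x - \sum_(k < N) p k x))%:E).
  by apply/measurable_EFinP; case: LS => ? ? _; exact: measurable_csq.
have S0 x : (0 <= (csq (f x - \sum_(k < N) p k x))%:E)%E.
  by rewrite lee_fin csq_ge0.
exists (fun x => 2%:E * (csq (f x - \sum_(k < N) p k x))%:E + 2%:E * W x)%E.
split.
- by apply: emeasurable_funD; exact: measurable_funeM.
- by move=> x; rewrite adde_ge0 ?mule_ge0.
- rewrite ge0_integralD//; last 4 first.
  + by move=> x _; rewrite mule_ge0.
  + exact: measurable_funeM.
  + by move=> x _; rewrite mule_ge0.
  + exact: measurable_funeM.
  rewrite !ge0_integralZl_EFin// inner_normE//.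
  apply: (@le_trans _ _ (2%:E * (e / 4)%:E + 2%:E * (10 * (e / 40))%:E)%E).
    by apply: leeD; rewrite lee_pmul2l// lee_fin.
  by rewrite -!EFinM -EFinD lee_fin; lra.
move=> x r Gr; exists N => n Nn.
rewrite -lee_fin; apply: le_trans (ltW Gr).
have -> : f x - \sum_(k < n) p k x =
    (f x - \sum_(k < N) p k x) + - \sum_(k < n) q k x.
  rewrite -addrA -opprD; congr (_ - _).
  rewrite -!(big_mkord xpredT (fun k => _ k x)) (@big_cat_nat _ _ _ N 0 n)//=.
  rewrite (@big_cat_nat _ _ _ N 0 n _ (fun k => q k x))//=.
  have -> : \sum_(0 <= k < N) q k x = 0.
    by rewrite big_nat big1// => k /andP[_ kN]; rewrite /q leqNgt kN.
  rewrite add0r.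
  by congr (_ + _); apply: eq_big_nat => k /andP[Nk _]; rewrite /q Nk.
apply: le_trans (_ : (2 * csq (f x - \sum_(k < N) p k x)
    + 2 * csq (\sum_(k < n) q k x))%:E <= _)%E.
  by rewrite lee_fin -[X in _ + 2 * X]csqN csqD_le.
by rewrite EFinD !EFinM leeD2l// lee_pmul2l// qW.
Qed.

End OrthogonalSeries.

(** * Convergence of the spherical sums *)

Section SphericalSums.
Context d (T : measurableType d) (R : realType).
Variable mu : {measure set T -> \bar R}.
Local Notation C := (R[i]).
Local Notation inner := (inner mu).
Local Notation L2 := (L2 mu).
Local Notation Re := complex.Re.
Variables (L : (T -> C) -> (T -> C) -> Prop) (lam : nat -> R) (A a : R).
Hypothesis saL : self_adjoint mu L.
Hypothesis nnL : nonnegative_op mu L.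
Hypothesis essL : essential_spectrum mu L = set0.
Hypothesis lam_lt : forall k, lam k < lam k.+1.
Hypothesis lam_all : forall z : R[i],
  op_eigenvalue mu L z <-> exists k, z = (lam k)%:C%C.
Hypothesis A0 : 0 < A.
Hypothesis a0 : 0 < a.
Hypothesis growth : \forall k \near \oo, (k.+1)%:R <= A * lam k `^ a.

Lemma eigenvalue_mono i j : (i < j)%N -> lam i < lam j.
Proof.
elim: j => // j IH; rewrite ltnS leq_eqVlt => /orP[/eqP->//|/IH ij].
exact: lt_trans ij (lam_lt j).
Qed.

Lemma eigenvalue_inj : injective lam.
Proof.
move=> i j ij; case: (ltngtP i j) => // /eigenvalue_mono;
  by rewrite ij ltxx.
Qed.

Lemma eigenvalue_ge0 k : 0 <= lam k.
Proof.
have [u [ku un0]] : op_eigenvalue mu L (lam k)%:C%C by apply/lam_all; exists k.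
have Lu := eigenspace_L2 saL ku.
have N0 : 0 < Re (inner u u).
  rewrite lt_neqAle Re_inner_ge0 andbT; apply/eqP => N0; apply: un0.
  by apply: inner_eq0 => //; rewrite innerE -N0.
have := nnL ku; rewrite innerZl// innerE -rmorphM /= ler0c.
by rewrite pmulr_lge0.
Qed.

Lemma eigenvalue_unbounded M : exists k, M < lam k.
Proof.
apply/not_existsP => lamM.
have {}lamM k : lam k <= M by rewrite leNgt; apply/negP/lamM.
have [N _ HN] := growth.
have Mb : 0 <= A * M `^ a by apply: mulr_ge0; [exact: ltW|exact: powR_ge0].
pose n := maxn N (Num.bound (A * M `^ a)).
have := HN n (leq_maxl _ _); apply/negP; rewrite -ltNge.
apply: (@le_lt_trans _ _ (A * M `^ a)).
  rewrite ler_pM2l//; apply: ge0_ler_powR; rewrite ?nnegrE//; first exact: ltW.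
    exact: eigenvalue_ge0.
  exact: le_trans (eigenvalue_ge0 0) (lamM 0%N).
apply: lt_le_trans (archi_boundP Mb) _.
by rewrite ler_nat leqW// leq_maxr.
Qed.

(** A spectral point that is not an eigenvalue cannot belong to the discrete spectrum, so it would
    be in the essential one. *)
Lemma nonspectral_resolvent z : (forall k, z <> lam k) ->
  resolvent_set mu L z%:C%C.
Proof.
move=> zlam; apply: contrapT => spz.
have [k /complexI] : exists k, z%:C%C = (lam k)%:C%C :> C; last exact: zlam.
apply/lam_all; apply: contrapT => neig.
have : essential_spectrum mu L z%:C%C by split => // -[].
by rewrite essL.
Qed.

Lemma ln2_le_log_eigenvalue k : ln 2 <= ln (2 + lam k).
Proof. by rewrite ler_ln ?posrE ?ltr_wpDr ?eigenvalue_ge0// lerDl eigenvalue_ge0. Qed.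

(* This is where the growth of the eigenvalues enters. *)
Lemma log_weight_bound : exists2 c : R, 0 < c &
  forall k, (trunc_log 2 k.+1).+1%:R <= c * ln (2 + lam k).
Proof.
have ln2 : 0 < ln (2 : R) by rewrite ln_gt0// ltr1n.
have [K _ HK] := growth.
(* [c1] serves k >= K: with t = [trunc_log 2 k.+1] and l = ln (2 + lam_k), growth gives t ln 2 <=
   |ln A| + a l, and the terms |ln A| / ln 2 and 1 are absorbed by l >= ln 2. [c2] covers the
   finitely many k < K, where t + 1 <= K + 1. *)
pose c1 := `|ln A| / ln 2 ^+ 2 + a / ln 2 + (ln 2)^-1.
pose c2 := K.+1%:R / ln 2 : R.
have c1_gt0 : 0 < c1.
  by rewrite ltr_wpDl ?invr_gt0// addr_ge0// divr_ge0// ?sqr_ge0// ltW.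
have c2_gt0 : 0 < c2 by rewrite divr_gt0// ltr0n.
exists (c1 + c2) => [|k]; first by rewrite addr_gt0.
have l2 := ln2_le_log_eigenvalue k; set l := ln (2 + lam k) in l2 *.
have l0 : 0 < l by exact: lt_le_trans l2.
set t := trunc_log 2 k.+1.
have tk : (2 ^ t <= k.+1)%N by exact: trunc_logP.
rewrite mulrDl.
have [Kk|kK] := leqP K k; last first.
  apply: (@le_trans _ _ (c2 * l)); last by rewrite lerDr mulr_ge0// ltW.
  apply: (@le_trans _ _ K.+1%:R).
    by rewrite ler_nat ltnS; have := ltn_expl t (isT : (1 < 2)%N); lia.
  by rewrite /c2 mulrAC -mulrA ler_peMr ?ler0n// ler_pdivlMr// mul1r.
apply: (@le_trans _ _ (c1 * l)); last by rewrite lerDl mulr_ge0// ltW.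
have kA := HK k Kk; rewrite /= in kA.
(* A zero eigenvalue would make the right side of the growth bound 0, since 0 to the power a > 0 is
   0; positivity permits taking logarithms. *)
have lk0 : 0 < lam k.
  rewrite lt_neqAle eigenvalue_ge0 andbT; apply/eqP => lk0.
  move: kA; rewrite -lk0 powR0 ?gt_eqF// mulr0; apply/negP.
  by rewrite -ltNge ltr0n.
have tl : t%:R * ln 2 <= `|ln A| + a * l.
  apply: (@le_trans _ _ (ln (A * lam k `^ a))).
    rewrite mulr_natl -lnXn// ler_ln ?posrE ?exprn_gt0//; last first.
      by rewrite mulr_gt0// powR_gt0.
    by apply: le_trans kA; rewrite -natrX ler_nat.
  rewrite lnM ?posrE ?powR_gt0// ln_powR; apply: lerD; first exact: ler_norm.
  by rewrite ler_pM2l// ler_ln ?posrE ?ltr_wpDr ?ltW// ltrDr.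
have tl' : t%:R <= (`|ln A| + a * l) / ln 2 by rewrite ler_pdivlMr.
rewrite -natr1; apply: (@le_trans _ _ ((`|ln A| + a * l) / ln 2 + 1)).
  by rewrite lerD2r.
have h1 : 1 <= (ln 2)^-1 * l by rewrite mulrC ler_pdivlMr// mul1r.
have h2 : `|ln A| / ln 2 <= `|ln A| / ln 2 ^+ 2 * l.
  rewrite expr2 invfM mulrA -mulrA ler_peMr// divr_ge0//; exact: ltW.
rewrite /c1 mulrDl (mulrDl _ _ l) mulrDl mulrAC.
by apply: lerD => //; apply: lerD => //; rewrite mulrAC.
Qed.

(** As the eigenvalues increase without bound, those up to r form an initial segment, ended by the
    least n with r < lam_n; so the sum over a set in [spherical_sum] has finite support and is not a
    default 0. The second clause makes n grow with r. *)
Lemma spherical_sum_partial (p : nat -> T -> C) (r : R) :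
  exists n, (forall x, spherical_sum lam p r x = \sum_(k < n) p k x) /\
    forall N, lam N <= r -> (N < n)%N.
Proof.
pose P n := r < lam n; have exP : exists n, P n by exact: eigenvalue_unbounded.
have [n Pn minn] := ex_minnP exP.
have lamE k : (lam k <= r) = (k < n)%N.
  apply/idP/idP => [kr|kn].
    rewrite ltnNge; apply/negP; rewrite leq_eqVlt => /orP[/eqP nk|/eigenvalue_mono nk].
      by move: Pn; rewrite /P nk ltNge kr.
    by move: (lt_trans Pn nk); rewrite ltNge kr.
  by rewrite leNgt; apply/negP => /minn; rewrite leqNgt kn.
exists n; split=> [x|N]; last by rewrite lamE.
rewrite /spherical_sum (@fsbig_ord C 0 _ n (fun k => p k x)); congr (\sum_(_ \in _) _).
by apply/seteqP; split => k /=; rewrite lamE.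
Qed.

Section FunctionalCalculus.
Variables (f g : T -> C) (p : nat -> T -> C).
Hypothesis fg : functional_calculus mu L (fun t => ln (2 + t)) f g.
Hypothesis pP : forall k, is_eigenprojection mu L (lam k)%:C%C f (p k).

Lemma eigenprojection_L2 k : L2 (p k).
Proof. by have [kp _] := pP k; exact: eigenspace_L2 kp. Qed.

Lemma eigenprojection_orth i j : i != j -> inner (p i) (p j) = 0.
Proof.
move=> ij; have [[ip _] [jp _]] := (pP i, pP j).
apply: eigenspace_orth saL _ _ _ _ _ ip jp.
by rewrite (inj_eq eigenvalue_inj).
Qed.

Lemma functional_calculus_L2 : L2 f /\ L2 g.
Proof. by have [E [_ [[Lf _] Lg _]]] := fg. Qed.

Lemma eigenprojection_expansion :
  Re (inner (fun x => f x - \sum_(k < n) p k x)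
            (fun x => f x - \sum_(k < n) p k x)) @[n --> \oo] --> (0 : R).
Proof.
have [Lf Lg] := functional_calculus_L2; have [E [[pE LE] _]] := fg.
apply: cvg_trans (eigen_expansion pE LE eigenvalue_inj nonspectral_resolvent Lf).
apply: near_eq_cvg; near=> n.
have LEf i : L2 (E [set lam i] f) by exact: (pvm_L2 pE).
have LS1 : L2 (fun x => f x - \sum_(k < n) p k x).
  by apply: L2B => //; apply: L2_sum => k; exact: eigenprojection_L2.
have LS2 : L2 (fun x => f x - \sum_(k < n) E [set lam k] f x).
  by apply: L2B => //; apply: L2_sum.
suff S12 : (fun x => f x - \sum_(k < n) E [set lam k] f x) =
    (fun x => f x - \sum_(k < n) p k x) %[ae mu].
  by rewrite (inner_ae LS2 LS2 LS1 LS1 S12 S12).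
have : {ae mu, forall x k, p k x = E [set lam k] f x}.
  apply: ae_foralln => k.
  have := eigenprojection_pvm saL pE LE eigenvalue_inj nonspectral_resolvent Lf
    (pP k).
  by apply: filterS => x /(_ Logic.I).
by apply: filterS => x px _; congr (_ - _); apply: eq_bigr => k _; rewrite px.
Unshelve. all: by end_near. Qed.

(** Since f - p_k is orthogonal to the eigenvector p_k, <g, p_k> = ln (2 + lam_k) <f, p_k> = ln (2 +
    lam_k) |p_k|^2, as [bessel] requires. *)
Lemma log_weighted_bessel n :
  \sum_(k < n) ln (2 + lam k) ^+ 2 * Re (inner (p k) (p k)) <= Re (inner g g).
Proof.
have [Lf Lg] := functional_calculus_L2; have [E [[pE LE] gE]] := fg.
apply: (@bessel _ _ _ mu p (fun k => ln (2 + lam k)) g n Lg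
  eigenprojection_L2 eigenprojection_orth) => k. have [kp fp] := pP k; have Lp := eigenprojection_L2 k.
have mln : measurable_fun setT (fun t : R => ln (2 + t)).
  by apply: measurableT_comp => //; exact: measurable_funD.
have ck := eigenvector_concentrated saL pE LE eigenvalue_inj
  nonspectral_resolvent kp.
rewrite (spectral_integral_inner pE mln gE Lp ck).
congr (_ * _); apply/eqP; rewrite -subr_eq0 -innerBl//; apply/eqP.
exact: fp.
Qed.

Lemma weighted_bessel (c : R) :
  (forall k, (trunc_log 2 k.+1).+1%:R <= c * ln (2 + lam k)) -> forall n,
  \sum_(k < n) (trunc_log 2 k.+1).+1%:R ^+ 2 * Re (inner (p k) (p k))
    <= c ^+ 2 * Re (inner g g).
Proof.
move=> hc n.
apply: (@le_trans _ _ (c ^+ 2 *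
    \sum_(k < n) ln (2 + lam k) ^+ 2 * Re (inner (p k) (p k)))).
  rewrite mulr_sumr; apply: ler_sum => k _; rewrite mulrA ler_wpM2r//.
    exact: Re_inner_ge0.
  rewrite -exprMn lerXn2r ?nnegrE ?ler0n//.
  exact: le_trans (ler0n _ _) (hc k).
by rewrite ler_wpM2l ?sqr_ge0// log_weighted_bessel.
Qed.

Lemma spherical_sum_ae_cvg : {ae mu, forall x,
  normc (spherical_sum lam p r x - f x) @[r --> +oo] --> (0 : R)}.
Proof.
have [Lf Lg] := functional_calculus_L2; have [c c0 hc] := log_weight_bound.
have := orthogonal_series_ae_cvg eigenprojection_L2 eigenprojection_orth Lf
  eigenprojection_expansion (weighted_bessel hc).
apply: filterS => x Hx; apply/cvgr0Pnorm_le => e e0.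
have e20 : 0 < e ^+ 2 by rewrite exprn_gt0.
have [N HN] := Hx _ e20.
near=> r; have [n [nE nN]] := spherical_sum_partial p r.
have Nr : lam N <= r by near: r; apply: nbhs_pinfty_ge; exact: num_real.
have n0 z : 0 <= normc z :> R by case: z => u v; exact: sqrtr_ge0.
rewrite ger0_norm//.
rewrite -(@ler_pXn2r _ 2)// ?nnegrE ?(ltW e0)//.
by rewrite -csq_normc -csqN opprB nE HN// ltnW// nN.
Unshelve. all: by end_near. Qed.

(** Every spherical sum is a partial sum, so the squared supremum lies below the majorant W at each
    point. The constant c is a parameter so that it can be fixed before f and g. *)
Lemma spherical_sum_maximal (c : R) (K : set T) :
  (forall k, (trunc_log 2 k.+1).+1%:R <= c * ln (2 + lam k)) ->
  (\int[mu]_(x in K)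
     (ereal_sup [set (normc (spherical_sum lam p r x))%:E
                | r in [set r : R | (0 < r)%R]]) ^+ 2
   <= (10 * c ^+ 2)%:E * (L2norm mu g) ^+ 2)%E.
Proof.
move=> hc; have [Lf Lg] := functional_calculus_L2.
have [W [mW W0 SW intW]] := rademacher_menshov eigenprojection_L2
  eigenprojection_orth (weighted_bessel hc).
have n0 z : 0 <= normc z :> R by case: z => u v; exact: sqrtr_ge0.
rewrite L2norm_sqr inner_normE// -EFinM -mulrA; apply: le_trans intW.
rewrite integral_mkcond; set s := (fun x => ereal_sup _ ^+ 2)%E.
have sup0 x : (0 <= ereal_sup [set (normc (spherical_sum lam p r x))%:E
    | r in [set r : R | (0 < r)%R]])%E.
  apply: (@le_trans _ _ (normc (spherical_sum lam p 1 x))%:E).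
    by rewrite lee_fin.
  by apply: ereal_sup_ubound; exists 1 => //=.
have s0 x : (0 <= s x)%E by exact: expe_ge0.
apply: ge0_le_integral_nonmeasurable => x.
  by rewrite /patch; case: ifP.
rewrite /patch; case: ifP => // _; rewrite /s.
case: (W x) (W0 x) (SW ^~ x) => [w| |]; [|by move=> _ _; exact: leey|by []].
rewrite lee_fin => w0 Sw; set t := ereal_sup _.
have tw : (t <= (Num.sqrt w)%:E)%E.
  apply: ub_ereal_sup => _ [r _ <-]; have [n [-> _]] := spherical_sum_partial p r.
  rewrite lee_fin -[normc _]ger0_norm// -sqrtr_sqr ler_wsqrtr// -csq_normc.
  by rewrite -lee_fin.
have t0 : (0 <= t)%E by exact: sup0.
apply: (@le_trans _ _ ((Num.sqrt w)%:E ^+ 2)%E).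
  by rewrite !expe2 lee_pmul.
by rewrite -EFin_expe sqr_sqrtr.
Qed.

End FunctionalCalculus.

End SphericalSums.

Theorem theorem1p2 (R : realType) (X : pmetricType R)
  (mu : {measure set (borelType X) -> \bar R})
  (L : (X -> R[i]) -> (X -> R[i]) -> Prop)
  (lam : nat -> R) (A a : R)
  (hX : separable_space X)
  (hLsa : self_adjoint mu L)
  (hLnonneg : nonnegative_op mu L)
  (hLdiscrete : essential_spectrum mu L = set0)
  (hlam_incr : forall k, lam k < lam k.+1)
  (hlam_all : forall z : R[i],
     op_eigenvalue mu L z <-> exists k, z = ((lam k)%:C)%C)
  (hA : 0 < A) (ha : 0 < a)
  (hlam_growth : \forall k \near \oo, (k.+1)%:R <= A * lam k `^ a) :
  (forall (f g : X -> R[i]) (p : nat -> X -> R[i]),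
     functional_calculus mu L (fun t => ln (2 + t)) f g ->
     (forall k, is_eigenprojection mu L ((lam k)%:C)%C f (p k)) ->
     {ae mu, forall x,
        normc (spherical_sum lam p r x - f x) @[r --> +oo] --> (0 : R)}) /\
  (forall K : set X, compact K ->
     exists2 CK : R, 0 < CK &
     forall (f g : X -> R[i]) (p : nat -> X -> R[i]),
       functional_calculus mu L (fun t => ln (2 + t)) f g ->
       (forall k, is_eigenprojection mu L ((lam k)%:C)%C f (p k)) ->
       (\int[mu]_(x in K)
          (ereal_sup [set (normc (spherical_sum lam p r x))%:E
                     | r in [set r : R | (0 < r)%R]]) ^+ 2
        <= CK%:E * (L2norm mu g) ^+ 2)%E).
Proof.
split=> [f g p fg pP|K _].
  exact: (spherical_sum_ae_cvg hLsa hLnonneg hLdiscrete hlam_incr hlam_all hA ha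
    hlam_growth fg pP).
(* c depends only on the eigenvalues and the growth constants, so 10 c^2 works for all f at once. *)
have [c c0 hc] := log_weight_bound hLsa hLnonneg hlam_all hA ha hlam_growth.
exists (10 * c ^+ 2) => [|f g p fg pP]; first by rewrite mulr_gt0 ?exprn_gt0.
exact: (spherical_sum_maximal hLsa hLnonneg hLdiscrete hlam_incr hlam_all hA ha
  hlam_growth fg pP K hc).
Qed.
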